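(* For every grapheur $\mathsf M\in\mathcal M$ and every $\epsilon>0$, letting $k=\lceil(174/\epsilon)^2\rceil$, there exist $N\le 2k$ and a graph $G\in\Delta^{N\times N}$ all of whose entries are integer multiples of $1/k$ (i.e., a graph on $k$ edges, counted with multiplicity and normalized) such that $W_\square(\mathsf M,\mathsf M_G)\le\epsilon$.
   Context: A grapheur is a random probability measure on $[0,1]^2$ of the form $\sum_{i,j}E_{i,j}\delta_{(T_i,T_j)}+\sum_i[\sigma_i(\delta_{T_i}\otimes\lambda)+\varsigma_i(\lambda\otimes\delta_{T_i})]+\theta\lambda^2+\vartheta\lambda_D$ ($T_i$ iid uniform on $[0,1]$; $\lambda,\lambda^2$ Lebesgue; $\lambda_D$ uniform probability on the diagonal; deterministic nonnegative coefficients summing to $1$); $\mathcal M$ is the set of grapheurs. $\Delta^{N\times N}$: nonnegative $N\times N$ matrices with entries summing to $1$. For $G\in\Delta^{N\times N}$, $\mathsf M_G=\sum_{i,j}G_{i,j}\delta_{(T_i,T_j)}$ with $T_i$ iid uniform. $W_\square(\mathsf M_1,\mathsf M_2)=\inf\sup_{S,T\subseteq[0,1]\text{ intervals}}\mathbb E|\mathsf M_1'(S\times T)-\mathsf M_2'(S\times T)|$, the infimum over couplings $(\mathsf M_1',\mathsf M_2')$ of $\mathsf M_1,\mathsf M_2$. *)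

(* Defs.v *)
From HB Require Import structures.
From mathcomp Require Import all_boot all_order all_algebra.
From mathcomp Require Import all_classical all_reals all_analysis.
From mathcomp Require Import measurable_realfun.
Set Implicit Arguments. Unset Strict Implicit. Unset Printing Implicit Defensive.
Import Order.TTheory GRing.Theory Num.Theory.
Import numFieldNormedType.Exports.
Local Open Scope classical_set_scope.
Local Open Scope ring_scope.
Local Open Scope ereal_scope.

(* Deterministic coefficients of a grapheur, indexed by nat (finitely many
   atoms are encoded by zero coefficients). *)
Record grapheur_coef (R : realType) := GrapheurCoef {
  gE : nat -> nat -> R ;
  gsig : nat -> R ;
  gvsig : nat -> R ;
  gtheta : R ;
  gvtheta : R
}.

Definition is_grapheur (R : realType) (c : grapheur_coef R) : Prop :=
  (forall i j, (0 <= gE c i j)%R) /\ (forall i, (0 <= gsig c i)%R) /\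
  (forall i, (0 <= gvsig c i)%R) /\ (0 <= gtheta c)%R /\ (0 <= gvtheta c)%R /\
  (\esum_(p in [set: nat * nat]) (gE c p.1 p.2)%:E)
  + (\esum_(i in [set: nat]) (gsig c i)%:E)
  + (\esum_(i in [set: nat]) (gvsig c i)%:E)
  + (gtheta c)%:E + (gvtheta c)%:E = 1.

Definition unit_itv (R : realType) : set R := `[(0:R)%R, (1:R)%R].
Arguments unit_itv R : clear implicits.

Definition iid_uniform (R : realType) d (Omega : measurableType d)
    (P : probability Omega R) (T : nat -> Omega -> R) : Prop :=
  (forall i, measurable_fun setT (T i)) /\
  forall (n : nat) (B : nat -> set R), (forall i, measurable (B i)) ->
    P (\bigcap_(i in `I_n) (T i @^-1` B i)) =
    \prod_(i < n) (@lebesgue_measure R) (B i `&` unit_itv R).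

(* The random measure sum E_{ij} delta_{(T_i,T_j)} + sum sigma_i (delta_{T_i} x lambda)
   + sum varsigma_i (lambda x delta_{T_i}) + theta lambda^2 + vartheta lambda_D,
   evaluated at omega and at a set A of [0,1]^2 (inside R x R);
   lambda = Lebesgue measure on [0,1], lambda_D = uniform probability on the diagonal. *)
Definition grapheur_rm (R : realType) (c : grapheur_coef R) d (Omega : measurableType d)
    (T : nat -> Omega -> R) (w : Omega) (A : set (R * R)) : \bar R :=
  let lam := @lebesgue_measure R in
  (\esum_(p in [set: nat * nat]) (gE c p.1 p.2)%:E * (\1_A (T p.1 w, T p.2 w))%:E)
  + (\esum_(i in [set: nat]) (gsig c i)%:E *
       lam [set y | unit_itv R y /\ A (T i w, y)])
  + (\esum_(i in [set: nat]) (gvsig c i)%:E *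
       lam [set x | unit_itv R x /\ A (x, T i w)])
  + (gtheta c)%:E * (lam \x lam) (A `&` (unit_itv R `*` unit_itv R))
  + (gvtheta c)%:E * lam [set x | unit_itv R x /\ A (x, x)].

Definition same_law (R : realType)
    d1 (O1 : measurableType d1) (P1 : probability O1 R) (X : O1 -> set (R * R) -> \bar R)
    d2 (O2 : measurableType d2) (P2 : probability O2 R) (Y : O2 -> set (R * R) -> \bar R)
  : Prop :=
  forall (n : nat) (A : nat -> set (R * R)) (B : nat -> set (\bar R)),
    (forall i, measurable (A i)) -> (forall i, measurable (B i)) ->
    P1 (\bigcap_(i in `I_n) [set w | B i (X w (A i))]) =
    P2 (\bigcap_(i in `I_n) [set w | B i (Y w (A i))]).

Definition has_grapheur_law (R : realType) (c : grapheur_coef R)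
    d (O : measurableType d) (P : probability O R) (X : O -> set (R * R) -> \bar R) : Prop :=
  forall d0 (O0 : measurableType d0) (P0 : probability O0 R) (T : nat -> O0 -> R),
    iid_uniform P0 T -> same_law P X P0 (grapheur_rm c T).

Definition random_measure (R : realType) d (O : measurableType d)
    (M : O -> {measure set (R * R)%type -> \bar R}) : Prop :=
  forall A, measurable A -> measurable_fun setT (fun w => M w A).

Definition W_box (R : realType) (c1 c2 : grapheur_coef R) : \bar R :=
  ereal_inf [set x | exists d (O : measurableType d) (P : probability O R)
      (M1 M2 : O -> {measure set (R * R)%type -> \bar R}),
      [/\ random_measure M1, random_measure M2,
          has_grapheur_law c1 P (fun w => M1 w), has_grapheur_law c2 P (fun w => M2 w) &
          x = ereal_sup [set y | exists S T : interval R,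
                [/\ [set` S] `<=` unit_itv R, [set` T] `<=` unit_itv R &
                    y = \int[P]_w `| M1 w ([set` S] `*` [set` T])
                                     - M2 w ([set` S] `*` [set` T]) | ] ] ] ].

Definition mx_coef (R : realType) (N : nat) (G : 'M[R]_N) : grapheur_coef R :=
  GrapheurCoef
    (fun i j => match @insub nat (fun k => k < N)%N _ i,
                      @insub nat (fun k => k < N)%N _ j with
                | Some i', Some j' => G i' j'
                | _, _ => 0%R end)
    (fun _ => 0%R) (fun _ => 0%R) 0%R 0%R.

(* Main.v *)
Require Import Defs.
From HB Require Import structures.
From mathcomp Require Import all_boot all_order all_algebra.
From mathcomp Require Import all_classical all_reals all_analysis.
From mathcomp Require Import measurable_realfun.
From mathcomp Require Import ring lra.
Set Implicit Arguments.
Unset Strict Implicit.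
Unset Printing Implicit Defensive.
Import Order.TTheory GRing.Theory Num.Theory.
Import numFieldNormedType.Exports.
Local Open Scope classical_set_scope.
Local Open Scope ring_scope.

(** Keep finitely many atoms of the grapheur, moving the lost mass to theta, and
spread the dust uniformly over k fresh vertices: this turns the grapheur into a
probability matrix E on a finite vertex set V, at cost O(1/sqrt k) since the
averages of the k fresh indicators concentrate.

Sampling k edges from E gives G with at most 2k vertices. For fixed intervals S
and T, the Hoeffding decomposition of sum_{u,v} (G - E)_{u,v} 1_S(T_u) 1_T(T_v)
has an L^2 norm controlled, uniformly in S and T, by the entries, the
off-diagonal row and column sums, and the trace of G - E. Every edge contributes
to at most 3 of these statistics, so a derandomized greedy choice of the edges
makes their sum of squares at most 3/k.

The coupling lets both graphs read the same i.i.d. sequence T. For fixed S and T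
only the quadrant of each T_v relative to (S, T) matters, so all expectations are
finite sums over maps from V to bool * bool. *)

(** * Expectation over finite i.i.d. families *)

Section FiniteExpectation.
Variables (R : realFieldType) (V S : finType) (p : S -> R).
Hypotheses (p_ge0 : forall s, 0 <= p s) (p_sum1 : \sum_s p s = 1).
Implicit Types (F G : {ffun V -> S} -> R).

Definition fexp F : R := \sum_(w : {ffun V -> S}) (\prod_v p (w v)) * F w.

Lemma fexp_prod (f : V -> S -> R) :
  fexp (fun w => \prod_v f v (w v)) = \prod_v \sum_s p s * f v s.
Proof.
by rewrite bigA_distr_bigA; apply: eq_bigr => w _; rewrite big_split.
Qed.

Lemma fexp_cst c : fexp (fun=> c) = c.
Proof.
rewrite /fexp -mulr_suml -(bigA_distr_bigA (fun=> p)) big1 ?mul1r// => v _.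
Qed.

Lemma eq_fexp F G : F =1 G -> fexp F = fexp G.
Proof. by move=> FG; apply: eq_bigr => w _; rewrite FG. Qed.

Lemma fexpD F G : fexp (fun w => F w + G w) = fexp F + fexp G.
Proof. by rewrite -big_split; apply: eq_bigr => w _; rewrite mulrDr. Qed.

Lemma fexpZ c F : fexp (fun w => c * F w) = c * fexp F.
Proof. by rewrite mulr_sumr; apply: eq_bigr => w _; rewrite mulrCA. Qed.

Lemma fexp_sum (I : finType) (F : I -> {ffun V -> S} -> R) :
  fexp (fun w => \sum_i F i w) = \sum_i fexp (F i).
Proof. by rewrite exchange_big; apply: eq_bigr => w _; rewrite mulr_sumr. Qed.

Lemma le_fexp F G : (forall w, F w <= G w) -> fexp F <= fexp G.
Proof.
by move=> FG; apply: ler_sum => w _; rewrite ler_wpM2l// prodr_ge0.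
Qed.

Lemma fexp_norm_le1 F : (forall w, `|F w| <= 1) -> `|fexp F| <= 1.
Proof.
move=> F1; rewrite ler_norml -{2}(fexp_cst 1) -(fexp_cst (-1)) !le_fexp// => w;
  by have := F1 w; rewrite ler_norml => /andP[].
Qed.

(** A function of one coordinate, padded with 1 at the others so that [fexp_prod] applies. *)
Definition at_coord (u : V) (f : S -> R) (v : V) (s : S) : R :=
  if v == u then f s else 1.

Lemma prod_at_coord u f (w : {ffun V -> S}) :
  \prod_v at_coord u f v (w v) = f (w u).
Proof.
rewrite (bigD1 u)//= big1 ?mulr1 /at_coord ?eqxx// => v /negbTE->//.
Qed.

(** By independence the expectation factors over coordinates; as [i] does not occur in [r], its
    factor is the mean of [f], namely 0. The list [r] may repeat coordinates. *)
Lemma fexp_centered (i : V) (f : S -> R) (r : seq (V * (S -> R))) :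
  \sum_s p s * f s = 0 -> i \notin [seq q.1 | q <- r] ->
  fexp (fun w => f (w i) * \prod_(q <- r) q.2 (w q.1)) = 0.
Proof.
move=> f0 ir.
rewrite (@eq_fexp _ (fun w => \prod_v (at_coord i f v (w v) *
    \prod_(q <- r) at_coord q.1 q.2 v (w v)))); last first.
  move=> w; rewrite big_split /= prod_at_coord exchange_big /=; congr (_ * _).
  by apply: eq_bigr => q _; rewrite prod_at_coord.
rewrite (fexp_prod (fun v s => at_coord i f v s * \prod_(q <- r) at_coord q.1 q.2 v s)).
rewrite (bigD1 i)//=; rewrite [X in X * _](_ : _ = 0) ?mul0r//.
rewrite -[RHS]f0; apply: eq_bigr => s _; rewrite /at_coord eqxx.
congr (_ * _); rewrite -[RHS]mulr1; congr (_ * _).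
elim: r ir => [|q r IH]; first by rewrite big_nil.
by rewrite big_cons inE negb_or => /andP[/negbTE-> /IH->]; rewrite mulr1.
Qed.

(* Cross terms survive only along the involution [tau], so AM-GM pairs them up. *)
Lemma fexp_sqr_le (I : finType) (tau : I -> I) (c : I -> R)
    (phi : I -> {ffun V -> S} -> R) : involutive tau ->
  (forall i w, `|phi i w| <= 1) ->
  (forall i j, j != i -> j != tau i -> fexp (fun w => phi i w * phi j w) = 0) ->
  fexp (fun w => (\sum_i c i * phi i w) ^+ 2) <= 2 * \sum_i c i ^+ 2.
Proof.
move=> tauK phi1 phi0.
pose K i j := fexp (fun w => phi i w * phi j w).
have K1 i j : `|K i j| <= 1.
  by apply: fexp_norm_le1 => w; rewrite normrM mulr_ile1.
have -> : fexp (fun w => (\sum_i c i * phi i w) ^+ 2) =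
    \sum_i \sum_j c i * c j * K i j.
  transitivity (fexp (fun w => \sum_i \sum_j c i * c j * (phi i w * phi j w))).
    apply: eq_fexp => w; rewrite expr2 mulr_suml; apply: eq_bigr => i _.
    by rewrite mulr_sumr; apply: eq_bigr => j _; rewrite mulrACA.
  rewrite fexp_sum; apply: eq_bigr => i _.
  by rewrite fexp_sum; apply: eq_bigr => j _; rewrite fexpZ.
have cK i j : c i * c j * K i j <= (c i ^+ 2 + c j ^+ 2) / 2.
  apply: le_trans (ler_norm _) _; rewrite normrM.
  apply: (@le_trans _ _ `|c i * c j|); first exact: ler_piMr.
  have := sqr_ge0 (c i - c j); have := sqr_ge0 (c i + c j).
  by rewrite ler_norml !expr2; lra.
(* [K i j] vanishes unless [j] is [i] or [tau i]; if these coincide, the two terms on the right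
   simply add up. *)
have cK2 i j : c i * c j * K i j <=
   (if j == i then c i ^+ 2 else 0) +
   (if j == tau i then (c i ^+ 2 + c (tau i) ^+ 2) / 2 else 0).
  have := cK i j; have := sqr_ge0 (c i); have := sqr_ge0 (c (tau i)).
  have [ji|ji] := eqVneq j i; have [jt|jt] := eqVneq j (tau i).
  - by rewrite -jt ji; lra.
  - by rewrite ji; lra.
  - by rewrite -jt; lra.
  - by rewrite /K phi0// mulr0 addr0.
apply: (@le_trans _ _ (\sum_i \sum_j
   ((if j == i then c i ^+ 2 else 0) +
    (if j == tau i then (c i ^+ 2 + c (tau i) ^+ 2) / 2 else 0)))).
  by apply: ler_sum => i _; apply: ler_sum => j _; exact: cK2.
under eq_bigr => i _ do rewrite big_split /= -!big_mkcond !big_pred1_eq.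
rewrite big_split /= -mulr_suml big_split /=.
(* The diagonal contributes one sum of squares and the pairs along [tau] another, whence the factor
   2. *)
have <- : \sum_i c i ^+ 2 = \sum_i c (tau i) ^+ 2.
  exact: (reindex_inj (inv_inj tauK)).
lra.
Qed.

(** AM-GM in the form [|F| <= h / 2 + F ^ 2 / (2 * h)] replaces Cauchy-Schwarz and avoids square
    roots. *)
Lemma fexp_norm_le h M F : 0 < h -> fexp (fun w => F w ^+ 2) <= M * h ^+ 2 ->
  fexp (fun w => `|F w|) <= (1 + M) / 2 * h.
Proof.
move=> h0 FM.
apply: (@le_trans _ _ (fexp (fun w => h / 2 + (2 * h)^-1 * (F w ^+ 2)))).
  apply: le_fexp => w; rewrite -(ler_pM2l (_ : 0 < 2 * h)); last by lra.
  rewrite mulrDr mulVKf; last by apply: lt0r_neq0; lra.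
  have := sqr_ge0 (`|F w| - h); rewrite -(real_normK (num_real (F w))) !expr2.
  by lra.
rewrite fexpD fexp_cst fexpZ.
have : (2 * h)^-1 * fexp (fun w => F w ^+ 2) <= (2 * h)^-1 * (M * h ^+ 2).
  by rewrite ler_wpM2l// invr_ge0; lra.
have -> : (2 * h)^-1 * (M * h ^+ 2) = M / 2 * h by field; apply: lt0r_neq0.
lra.
Qed.

End FiniteExpectation.

(** * Derandomized sampling from a finite distribution *)

Section Sampling.
Variables (R : realFieldType) (I A : finType) (mu : I -> R) (f : I -> A -> R).
Hypotheses (mu_ge0 : forall i, 0 <= mu i) (mu_sum1 : \sum_i mu i = 1).

Lemma exists_le_mean (g : I -> R) C : \sum_i mu i * g i <= C -> exists i, g i <= C.
Proof.
move=> gC; apply/existsP; apply: contraT; rewrite negb_exists => /forallP Cg.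
have mugC i : 0 <= mu i * (g i - C).
  by rewrite mulr_ge0// subr_ge0 ltW// ltNge.
have /eqP : \sum_i mu i * (g i - C) = 0.
  apply/eqP; rewrite eq_le sumr_ge0 ?andbT//.
  under eq_bigr do rewrite mulrBr.
  by rewrite sumrB -mulr_suml mu_sum1 mul1r subr_le0.
rewrite psumr_eq0// => /allP mu0.
have : \sum_i mu i = 0.
  apply: big1 => i _; have /implyP/(_ isT) := mu0 i (mem_index_enum i).
  rewrite mulf_eq0 => /orP[/eqP//|].
  by have := Cg i; rewrite -ltNge -subr_gt0 => /lt0r_neq0/negbTE->.
by move/eqP; rewrite mu_sum1 oner_eq0.
Qed.

Let m a := \sum_i mu i * f i a.

(* Method of conditional expectations: the next sample never increases the
   squared discrepancy by more than the variance of a single random sample. *)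
Lemma exists_low_discrepancy_sample B (fB : forall i, \sum_a f i a ^+ 2 <= B) k :
  exists s : seq I, size s = k /\
    \sum_a (\sum_(i <- s) f i a - k%:R * m a) ^+ 2 <= k%:R * B.
Proof.
elim: k => [|k [s [sk IH]]].
  exists [::]; split=> //; rewrite mul0r big1// => a _.
  by rewrite big_nil mul0r subr0 expr0n.
pose E a := \sum_(i <- s) f i a - k%:R * m a.
have [i iP] : exists i, \sum_a (E a + (f i a - m a)) ^+ 2 <= \sum_a E a ^+ 2 + B.
  apply: exists_le_mean.
  apply: (@le_trans _ _ (\sum_a E a ^+ 2 + \sum_i mu i * \sum_a f i a ^+ 2)); last first.
    rewrite lerD2l -[leRHS]mul1r -mu_sum1 mulr_suml.
    by apply: ler_sum => i _; rewrite ler_wpM2l.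
  under eq_bigr do rewrite mulr_sumr.
  under [X in _ <= _ + X]eq_bigr do rewrite mulr_sumr.
  rewrite exchange_big [X in _ <= _ + X]exchange_big -big_split /=.
  apply: ler_sum => a _.
  (* Expanding around [E a - m a], the mean over [i] is [E a ^+ 2 - m a ^+ 2] plus the second moment
     of [f]; the negative square is dropped. *)
  rewrite (eq_bigr (fun i => (mu i * (E a - m a) ^+ 2 +
     mu i * f i a * (2 * (E a - m a))) + mu i * f i a ^+ 2)); last first.
    by move=> i _; rewrite !expr2; ring.
  rewrite !big_split/= -!mulr_suml mu_sum1 mul1r -/(m a) lerD2r.
  by have := sqr_ge0 (m a); rewrite !expr2; lra.
exists (i :: s); split; first by rewrite /= sk.
rewrite -natr1 mulrDl mul1r; apply: le_trans (lerD IH (lexx B)).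
apply: le_trans iP; rewrite le_eqVlt; apply/orP; left; apply/eqP.
by apply: eq_bigr => a _; rewrite big_cons /E; congr (_ ^+ 2); ring.
Qed.

Lemma sum_count_mem (g : I -> R) (s : seq I) :
  \sum_i (count_mem i s)%:R * g i = \sum_(i <- s) g i.
Proof.
elim: s => [|i s IH].
  by rewrite big_nil big1// => i _; rewrite mul0r.
rewrite big_cons -IH.
have -> : g i = \sum_j (if j == i then g j else 0) by rewrite -big_mkcond big_pred1_eq.
rewrite -big_split /=; apply: eq_bigr => j _; rewrite natrD mulrDl eq_sym.
by case: eqP => _; rewrite ?mul1r ?mul0r.
Qed.

End Sampling.

(** * Second moments of cut statistics *)

Section EdgeFeatures.
Variables (R : realFieldType) (V : finType).

(** Summed against a signed matrix, the four summands of the index type give its entries, its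
    off-diagonal row sums, its off-diagonal column sums and its trace. *)
Definition edge_feature (q : V * V) (t : (V * V) + (V + (V + unit))) : R :=
  match t with
  | inl r => (q == r)%:R
  | inr (inl u) => ((q.1 != q.2) && (q.1 == u))%:R
  | inr (inr (inl v)) => ((q.1 != q.2) && (q.2 == v))%:R
  | inr (inr (inr _)) => (q.1 == q.2)%:R
  end.

Lemma sum_pick (I : finType) (i : I) (g : I -> R) : \sum_j (i == j)%:R * g j = g i.
Proof.
rewrite (bigD1 i)//= eqxx mul1r big1 ?addr0// => j /negbTE.
by rewrite eq_sym => ->; rewrite mul0r.
Qed.

Lemma sum_unit (g : unit -> R) : \sum_t g t = g tt.
Proof. by rewrite (bigD1 tt)//= big1 ?addr0// => -[]. Qed.

(** All features are 0 or 1: a non-loop switches on its entry, row and column, a loop only its entry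
    and the trace. *)
Lemma sum_edge_feature_sqr q : \sum_t edge_feature q t ^+ 2 <= 3.
Proof.
have sqrb (b : bool) : (b%:R : R) ^+ 2 = b%:R by case: b; rewrite ?expr1n ?expr0n.
have pick1 (I : finType) (i : I) : \sum_j (i == j)%:R = 1 :> R.
  by rewrite -[RHS](sum_pick i (fun=> 1)); under [RHS]eq_bigr do rewrite mulr1.
have pick_le1 (I : finType) (i : I) (b : bool) : \sum_j (b && (i == j))%:R <= 1 :> R.
  by case: b; rewrite ?pick1// big1.
rewrite !big_sumType /= sum_unit /=.
under eq_bigr do rewrite sqrb.
under [X in _ + (X + _)]eq_bigr do rewrite sqrb.
under [X in _ + (_ + (X + _))]eq_bigr do rewrite sqrb.
rewrite pick1 sqrb; have [q12|q12] := eqVneq q.1 q.2 => /=.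
  by rewrite !big1//; lra.
by rewrite !pick1; lra.
Qed.

End EdgeFeatures.

Section CutDiscrepancy.
Variables (R : realFieldType) (V : finType) (p : bool * bool -> R).
Hypotheses (p_ge0 : forall s, 0 <= p s) (p_sum1 : \sum_s p s = 1).
Local Notation S := (bool * bool)%type.
Implicit Types (w : {ffun V -> S}).

Definition in_row (s : S) : R := s.1%:R.
Definition in_col (s : S) : R := s.2%:R.
Definition in_both (s : S) : R := (s.1 && s.2)%:R.

Definition pmean (f : S -> R) := \sum_s p s * f s.

Lemma pmean_centered f : \sum_s p s * (f s - pmean f) = 0.
Proof.
under eq_bigr do rewrite mulrBr.
by rewrite sumrB -mulr_suml p_sum1 mul1r subrr.
Qed.

Lemma pmean_bounds f : (forall s, 0 <= f s <= 1) -> 0 <= pmean f <= 1.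
Proof.
move=> f01; apply/andP; split.
  by apply: sumr_ge0 => s _; rewrite mulr_ge0//; case/andP: (f01 s).
rewrite -p_sum1; apply: ler_sum => s _; rewrite ler_piMr//.
by case/andP: (f01 s).
Qed.

Lemma centered_norm f s : (forall s, 0 <= f s <= 1) -> `|f s - pmean f| <= 1.
Proof.
move=> f01; have /andP[? ?] := pmean_bounds f01; have /andP[? ?] := f01 s.
by rewrite ler_norml; lra.
Qed.

Lemma in_row01 s : 0 <= in_row s <= 1.
Proof. by rewrite /in_row ler0n lern1 leq_b1. Qed.

Lemma in_col01 s : 0 <= in_col s <= 1.
Proof. by rewrite /in_col ler0n lern1 leq_b1. Qed.

Lemma in_both01 s : 0 <= in_both s <= 1.
Proof. by rewrite /in_both ler0n lern1 leq_b1. Qed.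

Local Notation a := (pmean in_row).
Local Notation b := (pmean in_col).
Local Notation c := (pmean in_both).
Local Notation xi s := (in_row s - a).
Local Notation eta s := (in_col s - b).
Local Notation zeta s := (in_both s - c).

(** Injectivity of [g] places the centered summands at distinct coordinates, so they are pairwise
    orthogonal and [fexp_sqr_le] applies with [tau] the identity. *)
Lemma fexp_linear_norm (I : finType) (g : I -> V) (d : I -> R) (f : S -> R) h M :
  injective g -> (forall s, 0 <= f s <= 1) -> 0 < h ->
  \sum_i d i ^+ 2 <= M * h ^+ 2 ->
  fexp p (fun w => `|\sum_i d i * (f (w (g i)) - pmean f)|) <= (1 + 2 * M) / 2 * h.
Proof.
move=> g_inj f01 h0 dM; apply: fexp_norm_le => //.
rewrite -mulrA; apply: le_trans (ler_wpM2l _ dM) => //.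
apply: (@fexp_sqr_le R V _ p p_ge0 p_sum1 I id d
  (fun i w => f (w (g i)) - pmean f)) => //.
  by move=> i w; exact: centered_norm.
move=> i j ji _; rewrite -[RHS](@fexp_centered R V _ p (g i)
  (fun s => f s - pmean f) [:: (g j, fun s => f s - pmean f)]); last 2 first.
- exact: pmean_centered.
- by rewrite /= inE inj_eq// eq_sym.
by apply: eq_fexp => w; rewrite big_seq1.
Qed.

(** For a non-loop this is the second-order Hoeffding component. On a loop both indicators read the
    same vertex, their product is [in_both], and only its mean is removed. *)
Definition edge_fluct (q : V * V) w : R :=
  if q.1 == q.2 then zeta (w q.1) else xi (w q.1) * eta (w q.2).

Lemma edge_fluct_norm q w : `|edge_fluct q w| <= 1.
Proof.
rewrite /edge_fluct; case: ifP => _; first exact: (centered_norm _ in_both01).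
rewrite normrM mulr_ile1//; first exact: (centered_norm _ in_row01).
exact: (centered_norm _ in_col01).
Qed.

(** Some coordinate carries exactly one centered factor, and [fexp_centered] applies there. The
    reversed edge is a genuine exception, which explains the involution in [fexp_sqr_le]. *)
Lemma edge_fluct_orthogonal q r : r != q -> r != (q.2, q.1) ->
  fexp p (fun w => edge_fluct q w * edge_fluct r w) = 0.
Proof.
case: q r => [u v] [u' v'] /=; rewrite /edge_fluct /=.
have C := @fexp_centered R V _ p.
have z0 := pmean_centered in_both; have x0 := pmean_centered in_row.
have y0 := pmean_centered in_col.
rewrite !xpair_eqE.
have [->|uv] := eqVneq u v; have [->|uv'] := eqVneq u' v'; rewrite ?andbb.
- move=> vv _; rewrite -[RHS](C v (fun s => zeta s) [:: (v', fun s => zeta s)])//.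
    by apply: eq_fexp => w; rewrite big_seq1.
  by rewrite inE eq_sym.
- move=> _ _; have [uv|uv] := eqVneq u' v.
    rewrite -[RHS](C v' (fun s => eta s) [:: (v, fun s => zeta s); (u', fun s => xi s)])//.
      by apply: eq_fexp => w; rewrite big_cons big_seq1 /=; ring.
    by rewrite !inE negb_or [v' == v]eq_sym -uv [v' == u']eq_sym uv'.
  rewrite -[RHS](C u' (fun s => xi s) [:: (v, fun s => zeta s); (v', fun s => eta s)])//.
    by apply: eq_fexp => w; rewrite big_cons big_seq1 /=; ring.
  by rewrite !inE negb_or uv uv'.
- move=> _ _; have [uv1|uv1] := eqVneq u v'.
    rewrite -[RHS](C v (fun s => eta s) [:: (u, fun s => xi s); (v', fun s => zeta s)])//.
      by apply: eq_fexp => w; rewrite big_cons big_seq1 /=; ring.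
    by rewrite !inE negb_or -uv1 [v == u]eq_sym uv.
  rewrite -[RHS](C u (fun s => xi s) [:: (v, fun s => eta s); (v', fun s => zeta s)])//.
    by apply: eq_fexp => w; rewrite big_cons big_seq1 /=; ring.
  by rewrite !inE negb_or uv uv1.
(* Both edges are non-loops. If [u] is an endpoint of [r], then [v] is not, since otherwise [r]
   would be [q] or its reverse. *)
move=> rq rq'; have [u1|u1] := boolP (u \in [:: v; u'; v']); last first.
  rewrite -[RHS](C u (fun s => xi s)
    [:: (v, fun s => eta s); (u', fun s => xi s); (v', fun s => eta s)])//.
  by apply: eq_fexp => w; rewrite !big_cons big_nil /=; ring.
rewrite -[RHS](C v (fun s => eta s)
    [:: (u, fun s => xi s); (u', fun s => xi s); (v', fun s => eta s)])//.
  by apply: eq_fexp => w; rewrite !big_cons big_nil /=; ring.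
move: u1; rewrite /= !inE (negbTE uv) [v == u]eq_sym (negbTE uv) /= => /orP[]/eqP uE.
- have /negbTE-> : v != u' by rewrite -uE eq_sym.
  by move: rq; rewrite uE eqxx /= eq_sym.
- have /negbTE-> : v != v' by rewrite -uE eq_sym.
  by rewrite orbF; move: rq'; rewrite uE eqxx andbT eq_sym.
Qed.

(** In the Hoeffding decomposition the pair, row and column terms each cost at most [7 / 2 * h] and
    the trace term [2 * h], in total [25 / 2 * h]. *)
Lemma cut_discrepancy (D : V * V -> R) h : 0 < h -> \sum_q D q = 0 ->
  \sum_t (\sum_q D q * edge_feature R q t) ^+ 2 <= 3 * h ^+ 2 ->
  fexp p (fun w => `|\sum_q D q * (in_row (w q.1) * in_col (w q.2))|) <= 13 * h.
Proof.
move=> h0 D0; rewrite !big_sumType /= sum_unit /=.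
set s0 := \sum_q _; set s1 := \sum_u _; set s2 := \sum_v _; set tr := \sum_q _.
have sge (I : finType) (g : I -> R) : 0 <= \sum_i g i ^+ 2.
  by apply: sumr_ge0 => i _; rewrite sqr_ge0.
have s0_ge0 : 0 <= s0 by exact: sge.
have s1_ge0 : 0 <= s1 by exact: sge.
have s2_ge0 : 0 <= s2 by exact: sge.
have tr_ge0 := sqr_ge0 tr.
move=> stat.
have /andP[a0 a1] := pmean_bounds in_row01; have /andP[b0 b1] := pmean_bounds in_col01.
have /andP[c0 c1] := pmean_bounds in_both01.
pose dr u := \sum_q D q * ((q.1 != q.2) && (q.1 == u))%:R.
pose dc v := \sum_q D q * ((q.1 != q.2) && (q.2 == v))%:R.
pose U w := \sum_q D q * edge_fluct q w.
pose X w := \sum_u dr u * xi (w u).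
pose Y w := \sum_v dc v * eta (w v).
have UB : fexp p (fun w => `|U w|) <= (1 + 6) / 2 * h.
  apply: fexp_norm_le => //.
  have tauK : involutive (fun q : V * V => (q.2, q.1)) by case.
  apply: le_trans (fexp_sqr_le p_ge0 p_sum1 D tauK edge_fluct_norm edge_fluct_orthogonal) _.
  have -> : \sum_q D q ^+ 2 = s0.
    apply: eq_bigr => q _; congr (_ ^+ 2).
    by rewrite -(sum_pick q D); apply: eq_bigr => r _; rewrite mulrC eq_sym.
  lra.
have XB : fexp p (fun w => `|X w|) <= (1 + 2 * 3) / 2 * h.
  by apply: (@fexp_linear_norm _ id) => //; [exact: in_row01|rewrite -/s1; lra].
have YB : fexp p (fun w => `|Y w|) <= (1 + 2 * 3) / 2 * h.
  by apply: (@fexp_linear_norm _ id) => //; [exact: in_col01|rewrite -/s2; lra].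
have trB : `|tr| <= 2 * h.
  rewrite -(@ler_pXn2r _ 2)// ?nnegrE ?normr_ge0 ?mulr_ge0// ?(ltW h0)//.
  by rewrite (real_normK (num_real _)) exprMn; have := sqr_ge0 h; lra.
(* On loops the mean of the product is [c] instead of [a * b]; the trace term corrects this, and the
   constant [a * b] disappears because [D] sums to 0. *)
have decomp w : \sum_q D q * (in_row (w q.1) * in_col (w q.2)) =
    U w + b * X w + a * Y w + (c - a * b) * tr.
  have -> : X w = \sum_q D q * ((q.1 != q.2)%:R * xi (w q.1)).
    rewrite /X; under eq_bigr do rewrite mulr_suml.
    rewrite exchange_big /=; apply: eq_bigr => q _.
    rewrite -(sum_pick q.1 (fun u => xi (w u))) !mulr_sumr; apply: eq_bigr => u _.
    by rewrite -mulnb natrM; ring.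
  have -> : Y w = \sum_q D q * ((q.1 != q.2)%:R * eta (w q.2)).
    rewrite /Y; under eq_bigr do rewrite mulr_suml.
    rewrite exchange_big /=; apply: eq_bigr => q _.
    rewrite -(sum_pick q.2 (fun u => eta (w u))) !mulr_sumr; apply: eq_bigr => u _.
    by rewrite -mulnb natrM; ring.
  rewrite (eq_bigr (fun q => D q * edge_fluct q w
     + b * (D q * ((q.1 != q.2)%:R * xi (w q.1)))
     + a * (D q * ((q.1 != q.2)%:R * eta (w q.2)))
     + (c - a * b) * (D q * (q.1 == q.2)%:R) + D q * (a * b))).
    by rewrite !big_split /= -!mulr_sumr -mulr_suml D0 mul0r addr0.
  move=> q _; rewrite /edge_fluct; have [->|_] := eqVneq q.1 q.2 => /=; last by ring.
  have -> : in_row (w q.2) * in_col (w q.2) = in_both (w q.2) by rewrite -natrM mulnb.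
  ring.
apply: (@le_trans _ _ (fexp p (fun w => `|U w| + (`|X w| + (`|Y w| + 2 * h))))).
  apply: le_fexp => // w; rewrite decomp -!addrA.
  apply: le_trans (ler_normD _ _) _; rewrite lerD2l.
  apply: le_trans (ler_normD _ _) _; apply: lerD.
    by rewrite normrM ger0_norm// ler_piMl.
  apply: le_trans (ler_normD _ _) _; apply: lerD.
    by rewrite normrM ger0_norm// ler_piMl.
  rewrite normrM; apply: le_trans trB; rewrite ler_piMl// ler_norml.
  by have := mulr_ge0 a0 b0; have := mulr_ile1 a0 b0 a1 b1; lra.
rewrite !fexpD fexp_cst//; lra.
Qed.

End CutDiscrepancy.

(** * Dust replaced by fresh vertices *)

Lemma norm_dust_le (R : realFieldType) (e sg vs A B th vth x y X Y Z : R) :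
  0 <= A -> A <= sg -> 0 <= B -> B <= vs -> 0 <= th -> 0 <= vth -> 0 <= e ->
  e + sg + vs + th + vth = 1 -> 0 <= x -> x <= 1 -> 0 <= y -> y <= 1 ->
  `|(B + th * y) * X + ((A + th * x) * Y + vth * Z)| <= `|X| + (`|Y| + `|Z|).
Proof.
move=> A0 Asg B0 Bvs th0 vth0 e0 mass x0 x1 y0 y1.
(* All masses sum to 1, so these bounds keep the coefficients of [Y] and [X] below 1. *)
have A1 : A + th <= 1 by lra.
have B1 : B + th <= 1 by lra.
have vth1 : vth <= 1 by lra.
have contr t u : 0 <= t -> t <= 1 -> `|t * u| <= `|u|.
  by move=> t0 t1; rewrite normrM ger0_norm// ler_piMl.
apply: le_trans (ler_normD _ _) _; apply: lerD; last first.
  apply: le_trans (ler_normD _ _) _; apply: lerD; last exact: contr.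
  apply: contr; first by rewrite addr_ge0// mulr_ge0.
  by apply: le_trans A1; rewrite lerD2l ler_piMr.
apply: contr; first by rewrite addr_ge0// mulr_ge0.
by apply: le_trans B1; rewrite lerD2l ler_piMr.
Qed.

Section Blowup.
Variables (R : realFieldType) (n L : nat).
Variables (E : 'I_n -> 'I_n -> R) (sg vs : 'I_n -> R) (th vth : R).
Hypotheses (E0 : forall i j, 0 <= E i j) (sg0 : forall i, 0 <= sg i).
Hypotheses (vs0 : forall i, 0 <= vs i) (th0 : 0 <= th) (vth0 : 0 <= vth).
Hypothesis mass1 : \sum_i \sum_j E i j + \sum_i sg i + \sum_i vs i + th + vth = 1.
Hypothesis L_gt0 : (0 < L)%N.
Local Notation V := ('I_n + 'I_L)%type.
Local Notation ell := (L%:R^-1 : R).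

(* The vertices [inr l] are fresh; the [theta] dust uses all pairs of them, loops included. *)
Definition blowup (q : V * V) : R :=
  match q with
  | (inl i, inl j) => E i j
  | (inl i, inr _) => sg i * ell
  | (inr _, inl j) => vs j * ell
  | (inr l, inr m) => th * ell * ell + (l == m)%:R * (vth * ell)
  end.

Lemma blowup_ge0 q : 0 <= blowup q.
Proof.
have l0 : 0 <= ell by rewrite invr_ge0 ler0n.
by case: q => [[i|l] [j|m]] //=; rewrite ?addr_ge0 ?mulr_ge0.
Qed.

(** Each Lebesgue integral of the grapheur turns into an average [av] over fresh vertices, and the
    diagonal dust into an average along their loops. *)
Lemma sum_blowup (f g : V -> R) :
  let av (F : 'I_L -> R) := \sum_l ell * F l in
  \sum_q blowup q * (f q.1 * g q.2) =
  \sum_i \sum_j E i j * (f (inl i) * g (inl j))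
  + \sum_i sg i * f (inl i) * av (fun l => g (inr l))
  + \sum_j vs j * g (inl j) * av (fun l => f (inr l))
  + th * (av (fun l => f (inr l)) * av (fun l => g (inr l)))
  + vth * av (fun l => f (inr l) * g (inr l)).
Proof.
move=> av.
transitivity (\sum_u \sum_v blowup (u, v) * (f u * g v)).
  by rewrite pair_bigA; apply: eq_bigr => -[].
rewrite big_sumType /=.
under eq_bigr do rewrite big_sumType /=.
under [X in _ + X]eq_bigr do rewrite big_sumType /=.
rewrite !big_split /= -!addrA; congr (_ + (_ + _)).
- apply: eq_bigr => i _; rewrite /av mulr_sumr; apply: eq_bigr => l _; ring.
- rewrite exchange_big /=; congr (_ + _).
    by apply: eq_bigr => i _; rewrite /av mulr_sumr; apply: eq_bigr => l _; ring.
  rewrite /av big_distrlr /= !mulr_sumr -big_split /=; apply: eq_bigr => l _.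
  rewrite -[X in _ = _ + vth * (ell * X)](sum_pick l (fun m => f (inr l) * g (inr m))).
  rewrite !mulr_sumr -big_split /=; apply: eq_bigr => m _; ring.
Qed.

Lemma blowup_sum1 : \sum_q blowup q = 1.
Proof.
have L0 : (L%:R : R) != 0 by rewrite pnatr_eq0 -lt0n.
have av1 : \sum_(l < L) ell = 1 :> R by rewrite sumr_const card_ord -[_ *+ L]mulr_natl divff.
have := @sum_blowup (fun=> 1) (fun=> 1); rewrite /= !mulr1 av1.
move=> sumE.
rewrite (eq_bigr (fun q => blowup q * 1)) => [|q _]; last by rewrite mulr1.
rewrite sumE -[RHS]mass1; congr (_ + _ + _ + _ + _); rewrite ?mulr1//.
- by apply: eq_bigr => i _; apply: eq_bigr => j _; rewrite ?mulr1.
- by apply: eq_bigr => i _; rewrite !mulr1.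
- by apply: eq_bigr => i _; rewrite !mulr1.
Qed.

Variables (p : bool * bool -> R).
Hypotheses (p_ge0 : forall s, 0 <= p s) (p_sum1 : \sum_s p s = 1).
Local Notation in_row := (@in_row R).
Local Notation in_col := (@in_col R).
Local Notation in_both := (@in_both R).

(** The mass of a rectangle under the finite grapheur given the quadrants of its atoms, with the
    dust integrated exactly. Keeping the fresh coordinates in [w] lets the blow-up be compared on
    the same [w]. *)
Definition dust_value (w : {ffun V -> bool * bool}) : R :=
  \sum_i \sum_j E i j * (in_row (w (inl i)) * in_col (w (inl j)))
  + \sum_i sg i * in_row (w (inl i)) * pmean p in_col
  + \sum_j vs j * in_col (w (inl j)) * pmean p in_row
  + th * (pmean p in_row * pmean p in_col) + vth * pmean p in_both.

(** Three averages of [L] i.i.d. indicators deviate from their means by at most [3 / 2 * h] each in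
    expectation, in total [9 / 2 * h]. *)
Lemma blowup_error h : 0 < h -> ell <= h ^+ 2 ->
  fexp p (fun w => `|\sum_q blowup q * (in_row (w q.1) * in_col (w q.2)) -
    dust_value w|) <= 5 * h.
Proof.
move=> h0 Lh.
have L0 : (L%:R : R) != 0 by rewrite pnatr_eq0 -lt0n.
have l0 : 0 <= ell by rewrite invr_ge0 ler0n.
have av1 : \sum_(l < L) ell = 1 :> R by rewrite sumr_const card_ord -[_ *+ L]mulr_natl divff.
pose dev f (w : {ffun V -> bool * bool}) := \sum_l ell * (f (w (inr l)) - pmean p f).
have devE f (w : {ffun V -> bool * bool}) : \sum_l ell * f (w (inr l)) = dev f w + pmean p f.
  rewrite /dev; under [in RHS]eq_bigr do rewrite mulrBr.
  by rewrite sumrB -mulr_suml av1 mul1r subrK.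
have devB f : (forall s, 0 <= f s <= 1) -> fexp p (fun w => `|dev f w|) <= (1 + 2 * 1) / 2 * h.
  move=> f01; apply: (@fexp_linear_norm R V p p_ge0 p_sum1 _ (fun l : 'I_L => inr l)) => //.
    by move=> l m [].
  by rewrite sumr_const card_ord -[_ *+ L]mulr_natl expr2 mulrA divff// !mul1r.
have := devB _ (@in_row01 R); have := devB _ (@in_col01 R); have := devB _ (@in_both01 R).
move=> zB yB xB.
apply: (@le_trans _ _ (fexp p (fun w =>
  `|dev in_row w| + (`|dev in_col w| + `|dev in_both w|)))); last first.
  by rewrite !fexpD; lra.
apply: le_fexp => // w; have /= := sum_blowup (fun v => in_row (w v)) (fun v => in_col (w v)).
rewrite !devE => ->.
have -> : \sum_(l < L) ell * (in_row (w (inr l)) * in_col (w (inr l))) =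
    dev in_both w + pmean p in_both.
  by rewrite -devE; apply: eq_bigr => l _; rewrite /in_both -mulnb natrM.
rewrite /dust_value -!mulr_suml.
set A := \sum_i sg i * _; set B := \sum_i vs i * _.
have sgE : \sum_i \sum_j E i j >= 0 by do 2!apply: sumr_ge0 => ? _.
have A0 : 0 <= A by apply: sumr_ge0 => i _; rewrite mulr_ge0//; case/andP: (in_row01 R (w (inl i))).
have B0 : 0 <= B by apply: sumr_ge0 => i _; rewrite mulr_ge0//; case/andP: (in_col01 R (w (inl i))).
have A1 : A <= \sum_i sg i
  by apply: ler_sum => i _; rewrite ler_piMr//; case/andP: (in_row01 R (w (inl i))).
have B1 : B <= \sum_i vs i
  by apply: ler_sum => i _; rewrite ler_piMr//; case/andP: (in_col01 R (w (inl i))).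
have /andP[a0 a1] := pmean_bounds p_ge0 p_sum1 (@in_row01 R).
have yav : 0 <= dev in_col w + pmean p in_col <= 1.
  rewrite -devE; apply/andP; split.
    by apply: sumr_ge0 => l _; rewrite mulr_ge0//; case/andP: (in_col01 R (w (inr l))).
  rewrite -[leRHS]av1; apply: ler_sum => l _; rewrite ler_piMr//.
  by case/andP: (in_col01 R (w (inr l))).
move: yav; set Y := dev in_col w; set X := dev in_row w; set Z := dev in_both w.
set a := pmean p in_row in a0 a1 *; set b := pmean p in_col; set c := pmean p in_both.
set e := \sum_i \sum_j E i j * _ => /andP[y0 y1].
(* Splitting [(X + a) * (Y + b) - a * b] as [X * (Y + b) + a * Y] leaves coefficients in the unit
   interval. *)
rewrite (_ : _ - _ = (B + th * (Y + b)) * X + ((A + th * a) * Y + vth * Z)); last by ring.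
exact: (norm_dust_le _ _ _ A0 A1 B0 B1 th0 vth0 sgE mass1 a0 a1 y0 y1).
Qed.

End Blowup.

(** Sampling costs [13 * h] and the dust, spread over as many fresh vertices as there are edges,
    [5 * h]. The sample is chosen before [p], so it serves all rectangles at once. *)
Lemma finite_grapheur_sampling (R : realFieldType) (n k : nat) (h : R)
    (E : 'I_n -> 'I_n -> R) (sg vs : 'I_n -> R) (th vth : R) :
  (forall i j, 0 <= E i j) -> (forall i, 0 <= sg i) -> (forall i, 0 <= vs i) ->
  0 <= th -> 0 <= vth ->
  \sum_i \sum_j E i j + \sum_i sg i + \sum_i vs i + th + vth = 1 ->
  (0 < k)%N -> 0 < h -> k%:R^-1 <= h ^+ 2 ->
  exists s : seq (('I_n + 'I_k) * ('I_n + 'I_k)), size s = k /\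
  forall p : bool * bool -> R, (forall s, 0 <= p s) -> \sum_s p s = 1 ->
  fexp p (fun w => `|\sum_q (count_mem q s)%:R / k%:R * (in_row R (w q.1) * in_col R (w q.2))
     - dust_value E sg vs th vth p w|) <= 18 * h.
Proof.
move=> E0 sg0 vs0 th0 vth0 mass1 k0 h0 kh.
pose mu := @blowup R n k E sg vs th vth.
have mu0 q : 0 <= mu q by exact: blowup_ge0.
have mu1 : \sum_q mu q = 1 by exact: blowup_sum1.
have kR : 0 < k%:R :> R by rewrite ltr0n.
have [s [sk sP]] := exists_low_discrepancy_sample mu0 mu1
  (@sum_edge_feature_sqr R _) k.
exists s; split=> // p p0 p1.
pose D q := (count_mem q s)%:R / k%:R - mu q.
have countE (g : ('I_n + 'I_k) * ('I_n + 'I_k) -> R) :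
    \sum_q (count_mem q s)%:R / k%:R * g q = (\sum_(q <- s) g q) / k%:R.
  by rewrite -(sum_count_mem g) mulr_suml; apply: eq_bigr => q _; rewrite mulrAC.
have DB : fexp p (fun w => `|\sum_q D q * (in_row R (w q.1) * in_col R (w q.2))|) <= 13 * h.
  apply: cut_discrepancy => //.
    rewrite sumrB mu1; have := countE (fun=> 1); under eq_bigr do rewrite mulr1.
    by move=> ->; rewrite big_const_seq count_predT sk iter_addr_0 divff ?subrr// gt_eqF.
  (* Normalizing by [k] turns the squared discrepancy [k * 3] into [3 / k], at most [3 * h ^+ 2]. *)
  apply: (@le_trans _ _ (k%:R ^- 2 * (k%:R * 3))).
    apply: le_trans (ler_wpM2l _ sP); last by rewrite invr_ge0 exprn_ge0// ltW.
    rewrite mulr_sumr le_eqVlt; apply/orP; left; apply/eqP; apply: eq_bigr => t _.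
    rewrite -exprVn -exprMn; congr (_ ^+ 2).
    rewrite /D; under eq_bigr do rewrite mulrBl.
    rewrite sumrB countE; field; exact: lt0r_neq0.
  rewrite mulrA expr2 invfM mulfVK ?gt_eqF// mulrC ler_wpM2l//.
apply: (@le_trans _ _ (fexp p (fun w =>
  `|\sum_q D q * (in_row R (w q.1) * in_col R (w q.2))| +
  `|\sum_q mu q * (in_row R (w q.1) * in_col R (w q.2)) - dust_value E sg vs th vth p w|))).
  apply: le_fexp => // w; apply: le_trans (ler_normD _ _).
  rewrite addrA -big_split /= le_eqVlt; apply/orP; left; apply/eqP; congr `|_ - _|.
  by apply: eq_bigr => q _; rewrite -mulrDl subrK.
rewrite fexpD; have := blowup_error E0 sg0 vs0 th0 vth0 mass1 k0 p0 p1 h0 kh.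
rewrite -/mu; lra.
Qed.

(** * Grapheurs as random measures *)

Section IidUniform.
Local Open Scope ereal_scope.
Context (R : realType) d (O : measurableType d) (P : probability O R).
Variable T : nat -> O -> R.
Hypothesis iidT : iid_uniform P T.

Lemma lebesgue_unit_itv : (@lebesgue_measure R) (unit_itv R) = 1.
Proof. by rewrite lebesgue_measure_itv/= lte_fin ltr01 oppr0 adde0. Qed.

(** [iid_uniform] speaks of initial segments only; indices missed by [e] are filled with [setT],
    whose factor is the mass 1 of the unit interval. *)
Lemma iid_uniform_bigcap (V : finType) (e : V -> nat) (B : V -> set R) :
  injective e -> (forall v, measurable (B v)) ->
  P (\bigcap_v (T (e v) @^-1` B v)) = \prod_v (@lebesgue_measure R) (B v `&` unit_itv R).
Proof.
move=> e_inj mB.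
pose m := (\max_v e v).+1.
have em v : (e v < m)%N by rewrite ltnS leq_bigmax.
pose e' v : 'I_m := Ordinal (em v).
have e'_inj : injective e' by move=> u v [] /e_inj.
pose B' i := if [pick v | e v == i] is Some v then B v else setT.
have B'e v : B' (e v) = B v.
  rewrite /B'; case: pickP => [u /eqP/e_inj->//|/(_ v)].
  by rewrite eqxx.
have -> : \bigcap_v (T (e v) @^-1` B v) = \bigcap_(i in `I_m) (T i @^-1` B' i).
  apply/seteqP; split=> w /= H.
    move=> i /= im; rewrite /preimage /= /B'; case: pickP => [v /eqP <-|//].
    exact: H.
  by move=> v _ /=; rewrite -B'e; apply: H => /=.
rewrite (iidT.2 m) => [|i]; last by rewrite /B'; case: pickP.
rewrite (bigID (fun i : 'I_m => i \in finset.imset e' (mem V))) /=.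
rewrite [X in _ * X]big1 ?mule1 => [|i /imsetP iV]; last first.
  rewrite /B'; case: pickP => [v /eqP vi|_]; last by rewrite setTI lebesgue_unit_itv.
  by case: iV; exists v => //; apply: val_inj.
rewrite big_imset/=; last by move=> ? ? _ _; exact: e'_inj.
by apply: eq_bigr => v _; rewrite B'e.
Qed.

Lemma iid_uniform_inj (g : nat -> nat) :
  injective g -> iid_uniform P (fun i => T (g i)).
Proof.
move=> g_inj; split=> [i|n B mB]; first exact: iidT.1.
rewrite -(@iid_uniform_bigcap _ (fun i : 'I_n => g i) (fun i => B i))//; last first.
  by move=> i j /g_inj; exact: val_inj.
congr (P _); apply/seteqP; split=> w /= H i.
  by move=> _; apply: H => /=.
by move=> /= ni; apply: (H (Ordinal ni)).
Qed.

End IidUniform.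

Section GrapheurMeasure.
Local Open Scope ereal_scope.
Context (R : realType) (c : grapheur_coef R).
Hypothesis hc : is_grapheur c.
Local Notation lam := (@lebesgue_measure R).

Lemma gE_ge0 i j : (0 <= gE c i j)%R. Proof. by case: hc. Qed.
Lemma gsig_ge0 i : (0 <= gsig c i)%R. Proof. by case: hc => _ []. Qed.
Lemma gvsig_ge0 i : (0 <= gvsig c i)%R. Proof. by case: hc => _ [_ []]. Qed.
Lemma gtheta_ge0 : (0 <= gtheta c)%R. Proof. by case: hc => _ [_ [_ []]]. Qed.
Lemma gvtheta_ge0 : (0 <= gvtheta c)%R. Proof. by case: hc => _ [_ [_ [_ []]]]. Qed.

Lemma measurable_unit_itv : measurable (unit_itv R).
Proof. exact: measurable_itv. Qed.

(* Lebesgue measure lives on [measurableTypeR R], which has the same measurable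
   sets as [R] but another display. *)
Let lamU : {measure set (measurableTypeR R) -> \bar R} :=
  mrestr lam (measurable_unit_itv : @measurable _ (measurableTypeR R) _).

Let square_measure : {measure set (R * R)%type -> \bar R} :=
  @measure_function_pushforward__canonical__measure_function_Measure _ _
    (measurableTypeR R * measurableTypeR R)%type (R * R)%type R
    (mrestr (lam \x lam) (measurableX (measurable_unit_itv : @measurable _ (measurableTypeR R) _)
      (measurable_unit_itv : @measurable _ (measurableTypeR R) _))) id
    (@measurable_id _ (R * R)%type setT).

Lemma esum_pair_nneseries (f : nat -> nat -> \bar R) : (forall i j, 0 <= f i j) ->
  \esum_(p in [set: nat * nat]) f p.1 p.2 = \sum_(i <oo) \sum_(j <oo) f i j.
Proof.
move=> f0; rewrite nneseries_esumT; last by move=> i; exact: nneseries_ge0.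
rewrite [RHS](eq_esum (b := fun i => \esum_(j in setT) f i j)); last first.
  by move=> i _; rewrite nneseries_esumT.
rewrite esum_esum//; congr esum.
by apply/seteqP; split=> // -[].
Qed.

Let image_measure (f : R -> R * R) (mf : measurable_fun setT f) :
    {measure set (R * R)%type -> \bar R} :=
  @measure_function_pushforward__canonical__measure_function_Measure _ _
    (measurableTypeR R) (R * R)%type R lamU f mf.

(** [W_box] asks for genuine measures whereas [grapheur_rm] is a bare set function, so it is rebuilt
    from measure constructors at fixed points [t]. *)
Definition grapheur_measure (t : nat -> R) : {measure set (R * R)%type -> \bar R} :=
  measure_add
   (measure_add
    (mseries (fun i => mseries (fun j =>
       mscale (NngNum (gE_ge0 i j)) (dirac (t i, t j))) 0) 0)
    (measure_add
      (mseries (fun i => mscale (NngNum (gsig_ge0 i)) (image_measure (measurable_pair1 (t i)))) 0)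
      (mseries (fun i => mscale (NngNum (gvsig_ge0 i)) (image_measure (measurable_pair2 (t i)))) 0)))
   (measure_add
    (mscale (NngNum gtheta_ge0) square_measure)
    (mscale (NngNum gvtheta_ge0) (image_measure
       (measurable_fun_pair (@measurable_id _ R setT) (@measurable_id _ R setT))))).

Lemma grapheur_measureE d (O : measurableType d) (T : nat -> O -> R) w A :
  grapheur_measure (T^~ w) A = grapheur_rm c T w A.
Proof.
rewrite /grapheur_measure /grapheur_rm.
do 3![rewrite /= /msum ?(big_ord_recl, big_ord0) ?adde0 /=].
rewrite !addeA; congr (_ + _ + _ + _ + _).
- rewrite (esum_pair_nneseries (f := fun i j => (gE c i j)%:E * (\1_A (T i w, T j w))%:E))//.
  by move=> i j; rewrite -EFinM lee_fin mulr_ge0// gE_ge0.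
- rewrite -nneseries_esumT; last by move=> i; rewrite mule_ge0// lee_fin gsig_ge0.
  apply: eq_eseriesr => i _; congr (_ * lam _).
  by rewrite setIC.
- rewrite -nneseries_esumT; last by move=> i; rewrite mule_ge0// lee_fin gvsig_ge0.
  apply: eq_eseriesr => i _; congr (_ * lam _).
  by rewrite setIC.
- by congr (_ * lam _); rewrite setIC.
Qed.

(** The sums become series of measurable functions; dust attached to an atom is the measure of a
    section, which is measurable in the position of the atom. *)
Lemma measurable_grapheur_rm d (O : measurableType d) (T : nat -> O -> R) A :
  (forall i, measurable_fun setT (T i)) -> measurable A ->
  measurable_fun setT (fun w => grapheur_rm c T w A).
Proof.
move=> mT mA; rewrite /grapheur_rm.
apply: emeasurable_funD; last exact: measurable_cst.
apply: emeasurable_funD; last exact: measurable_cst.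
have mU := measurable_unit_itv.
apply: emeasurable_funD; first apply: emeasurable_funD.
- rewrite (_ : (fun _ => _) = fun w => \sum_(i <oo) \sum_(j <oo)
    ((gE c i j)%:E * (\1_A (T i w, T j w))%:E)); last first.
    apply/funext => w.
    rewrite (esum_pair_nneseries (f := fun i j => (gE c i j)%:E * (\1_A (T i w, T j w))%:E))//.
    by move=> i j; rewrite -EFinM lee_fin mulr_ge0// gE_ge0.
  apply: ge0_emeasurable_sum => [i w _ _|i _].
    by apply: nneseries_ge0 => j _ _; rewrite -EFinM lee_fin mulr_ge0// gE_ge0.
  apply: ge0_emeasurable_sum => [j w _ _|j _].
    by rewrite -EFinM lee_fin mulr_ge0// gE_ge0.
  apply: emeasurable_funM; first exact: measurable_cst.
  apply/measurable_EFinP.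
  apply: (measurableT_comp (f := (\1_A : R * R -> R))); first exact: measurable_indic.
  exact: measurable_fun_pair.
(* Intersecting [A] with a strip moves the condition [unit_itv] inside the section. *)
- rewrite (_ : (fun _ => _) = fun w => \sum_(i <oo) ((gsig c i)%:E *
      (lam \o xsection (A `&` (setT `*` unit_itv R))) (T i w))); last first.
    apply/funext => w; rewrite -nneseries_esumT; last first.
      by move=> i; rewrite mule_ge0// lee_fin gsig_ge0.
    apply: eq_eseriesr => i _; congr (_ * lam _).
    by apply/seteqP; split=> y; rewrite /xsection /= inE /=; [move=> [? ?]|move=> [? []]].
  apply: ge0_emeasurable_sum => [i w _ _|i _]; first by rewrite mule_ge0// lee_fin gsig_ge0.
  apply: emeasurable_funM; first exact: measurable_cst.
  apply: measurableT_comp => //; apply: measurable_fun_xsection.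
  by apply: measurableI => //; exact: measurableX.
- rewrite (_ : (fun _ => _) = fun w => \sum_(i <oo) ((gvsig c i)%:E *
      (lam \o ysection (A `&` (unit_itv R `*` setT))) (T i w))); last first.
    apply/funext => w; rewrite -nneseries_esumT; last first.
      by move=> i; rewrite mule_ge0// lee_fin gvsig_ge0.
    apply: eq_eseriesr => i _; congr (_ * lam _).
    by apply/seteqP; split=> y; rewrite /ysection /= inE /=; [move=> [? ?]|move=> [? []]].
  apply: ge0_emeasurable_sum => [i w _ _|i _]; first by rewrite mule_ge0// lee_fin gvsig_ge0.
  apply: emeasurable_funM; first exact: measurable_cst.
  apply: measurableT_comp => //; apply: measurable_fun_ysection.
  by apply: measurableI => //; exact: measurableX.
Qed.

Lemma random_measure_grapheur d (O : measurableType d) (T : nat -> O -> R) :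
  (forall i, measurable_fun setT (T i)) ->
  random_measure (fun w => grapheur_measure (T^~ w)).
Proof.
move=> mT A mA; under eq_fun do rewrite grapheur_measureE.
exact: measurable_grapheur_rm.
Qed.

End GrapheurMeasure.

(** * The law of a grapheur *)

Section GrapheurLaw.
Local Open Scope ereal_scope.
Context (R : realType).

(** The pi-system generating the product sigma-algebra on sequences. *)
Definition cylinders : set (set (nat -> R)) :=
  [set Z | exists n (B : nat -> set R), (forall i, measurable (B i)) /\
     Z = \bigcap_(i in `I_n) [set t | B i (t i)]].

Local Notation path_space := (g_sigma_algebraType cylinders).

Lemma setI_closed_cylinders : setI_closed cylinders.
Proof.
move=> _ _ [n [B [mB ->]]] [m [C [mC ->]]].
exists (maxn n m), (fun i => (if (i < n)%N then B i else setT) `&`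
                             (if (i < m)%N then C i else setT)); split.
  by move=> i; apply: measurableI; case: ifP.
apply/seteqP; split=> t /=.
  by move=> [tB tC] i /= _; split; case: ifP => // H; [exact: tB|exact: tC].
move=> H; split=> i /= ilt.
  by have [] := H i; rewrite /= ?ilt// leq_max ilt.
by have [] := H i; rewrite /= ?ilt// leq_max ilt orbT.
Qed.

Lemma measurable_coord i : measurable_fun setT (fun t : path_space => t i : R).
Proof.
move=> _ B mB; rewrite setTI; apply: sub_sigma_algebra.
exists i.+1, (fun j => if j == i then B else setT); split.
  by move=> j; case: ifP.
apply/seteqP; split=> t /=; first by move=> tB j /= _; case: eqP => [->|].
by move=> /(_ i (ltnSn i)) /=; rewrite eqxx.
Qed.

Lemma measurable_path d (O : measurableType d) (T : nat -> O -> R) :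
  (forall i, measurable_fun setT (T i)) ->
  measurable_fun setT (fun w => (T^~ w : path_space)).
Proof.
move=> mT; apply: (@measurability _ _ O path_space setT (fun w => T^~ w) cylinders) => //.
move=> _ [_ [n [B [mB ->]]] <-]; rewrite setTI preimage_bigcap.
apply: fin_bigcap_measurable => // i _.
by rewrite -[X in measurable X]setTI; exact: mT.
Qed.

(** Both sequences push their probabilities to measures on path space that agree on the pi-system of
    cylinders, hence everywhere. *)
Lemma iid_uniform_law_unique d1 (O1 : measurableType d1) (P1 : probability O1 R)
    (T1 : nat -> O1 -> R) d2 (O2 : measurableType d2) (P2 : probability O2 R)
    (T2 : nat -> O2 -> R) (Z : set path_space) :
  iid_uniform P1 T1 -> iid_uniform P2 T2 -> measurable Z ->
  P1 ((fun w => T1^~ w) @^-1` Z) = P2 ((fun w => T2^~ w) @^-1` Z).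
Proof.
move=> [mT1 iid1] [mT2 iid2] mZ.
pose m1 : {measure set path_space -> \bar R} :=
  measure_function_pushforward__canonical__measure_function_Measure P1 (measurable_path mT1).
pose m2 : {measure set path_space -> \bar R} :=
  measure_function_pushforward__canonical__measure_function_Measure P2 (measurable_path mT2).
rewrite -[LHS]/(m1 Z) -[RHS]/(m2 Z).
apply: (@measure_unique _ R path_space cylinders (fun=> setT)) => //.
- exact: setI_closed_cylinders.
- move=> _; exists 0%N, (fun=> setT); split=> //.
  by apply/seteqP; split.
- by apply/seteqP; split=> // t _; exists 0%N.
- move=> _ [n [B [mB ->]]].
  by rewrite /m1 /m2 /= /pushforward !preimage_bigcap iid1// iid2.
- by move=> _; rewrite /m1 /= /pushforward preimage_setT probability_setT ltry.
Qed.

Lemma has_grapheur_law_iid (c : grapheur_coef R) (hc : is_grapheur c)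
    d (O : measurableType d) (P : probability O R) (T : nat -> O -> R) :
  iid_uniform P T -> has_grapheur_law c P (fun w => grapheur_measure hc (T^~ w)).
Proof.
move=> iidT d0 O0 P0 T0 iidT0 n A B mA mB.
(* Running [grapheur_rm] on the coordinate process shows that the joint event is the preimage of a
   measurable set of paths, so only the law of the sequence matters. *)
pose Z : set path_space :=
  \bigcap_(i in `I_n) [set t | B i (grapheur_rm c (fun i (t : path_space) => t i) t (A i))].
have mZ : measurable Z.
  apply: fin_bigcap_measurable => // i _.
  rewrite -[X in measurable X]setTI; apply: measurable_grapheur_rm => //.
  exact: measurable_coord.
have := iid_uniform_law_unique iidT iidT0 mZ.
rewrite /Z !preimage_bigcap; congr (_ = _); congr (P _).
apply: eq_bigcapr => i _; apply/seteqP; split=> w /=; by rewrite grapheur_measureE.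
Qed.

End GrapheurLaw.

(** * Reduction to finite expectations *)

Section FiniteValued.
Local Open Scope ereal_scope.
Context (R : realType) d (X : measurableType d) (mu : {measure set X -> \bar R}).
Variables (W : finType) (phi : X -> W).
Hypothesis mphi : forall u, measurable (phi @^-1` [set u]).

Lemma measurable_preimage_finite (Y : set W) : measurable (phi @^-1` Y).
Proof.
rewrite (_ : _ @^-1` _ = \bigcup_(u in Y) (phi @^-1` [set u])).
  by apply: fin_bigcup_measurable.
apply/seteqP; split=> x /=; first by move=> Yx; exists (phi x).
by case=> u Yu /= ->.
Qed.

Let finite_valuedE (F : W -> R) x :
  (F (phi x))%:E = \sum_u (F u)%:E * (\1_(phi @^-1` [set u]) x)%:E.
Proof.
rewrite (bigD1 (phi x))//= big1 ?adde0 => [|u ux].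
  by rewrite indicE mem_set// mule1.
by rewrite indicE memNset ?mule0//= => xu; rewrite -xu eqxx in ux.
Qed.

Let measurable_finite_term (F : W -> R) u :
  measurable_fun setT (fun x => (F u)%:E * (\1_(phi @^-1` [set u]) x)%:E).
Proof.
apply: emeasurable_funM; first exact: measurable_cst.
by apply/measurable_EFinP; exact: measurable_indic.
Qed.

Lemma measurable_finite_valued (F : W -> R) :
  measurable_fun setT (fun x => (F (phi x))%:E).
Proof.
under eq_fun do rewrite finite_valuedE.
by apply: emeasurable_sum => u; exact: measurable_finite_term.
Qed.

Lemma ge0_integral_finite_valued (D : set X) (F : W -> R) :
  measurable D -> (forall u, 0 <= F u)%R ->
  \int[mu]_(x in D) (F (phi x))%:E = \sum_u (F u)%:E * mu (phi @^-1` [set u] `&` D).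
Proof.
move=> mD F0; under eq_integral do rewrite finite_valuedE.
rewrite ge0_integral_sum//; last 2 first.
- by move=> u; apply: measurable_funTS; exact: measurable_finite_term.
- by move=> u x _; rewrite mule_ge0// lee_fin.
apply: eq_bigr => u _; rewrite ge0_integralZl ?lee_fin//.
- by rewrite integral_indic.
- by apply/measurable_EFinP; apply: measurable_funTS; exact: measurable_indic.
Qed.

End FiniteValued.

Section Rectangle.
Local Open Scope ereal_scope.
Context (R : realType) (S T : set R).
Hypotheses (mS : measurable S) (mT : measurable T).
Local Notation lam := (@lebesgue_measure R).
Local Notation U := (unit_itv R).

Definition quadrant (t : R) : bool * bool := (t \in S, t \in T).

Lemma measurable_quadrant s : measurable (quadrant @^-1` [set s]).
Proof.
have mb (A : set R) (b : bool) : measurable A -> measurable [set t | (t \in A) = b].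
  move=> mA; case: b.
    rewrite (_ : [set _ | _] = A)//.
    by apply/seteqP; split=> t /=; [move/set_mem|move/mem_set].
  rewrite (_ : [set _ | _] = ~` A); first exact: measurableC.
  apply/seteqP; split=> t /=; first by move=> tA At; rewrite mem_set in tA.
  by move=> ?; rewrite memNset.
rewrite (_ : _ @^-1` _ = [set t | (t \in S) = s.1] `&` [set t | (t \in T) = s.2]).
  by apply: measurableI; exact: mb.
by apply/seteqP; split=> t; rewrite /quadrant /=; case: s => a b /= [-> ->].
Qed.

Definition quadrant_law (s : bool * bool) : R :=
  fine (lam (quadrant @^-1` [set s] `&` U)).

Lemma quadrant_lawE s : (quadrant_law s)%:E = lam (quadrant @^-1` [set s] `&` U).
Proof.
rewrite fineK// ge0_fin_numE//; apply: (@le_lt_trans _ _ (lam U)).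
  apply: le_measure; rewrite ?inE.
  - exact: (measurableI _ _ (measurable_quadrant s) (@measurable_unit_itv R)).
  - exact: measurable_unit_itv.
  - exact: subIsetr.
by rewrite lebesgue_unit_itv ltry.
Qed.

Lemma quadrant_law_ge0 s : (0 <= quadrant_law s)%R.
Proof. exact: fine_ge0. Qed.

(** The row, column and diagonal formulas below are the cases [s.1], [s.2] and [s.1 && s.2]. *)
Lemma lebesgue_quadrant (f : pred (bool * bool)) :
  lam [set t | U t /\ f (quadrant t)] = (pmean quadrant_law (fun s => (f s)%:R))%:E.
Proof.
rewrite (_ : [set t | _] = (quadrant @^-1` [set s | f s]) `&` U); last first.
  by apply/seteqP; split=> t [].
have mq := measurable_preimage_finite measurable_quadrant [set s | f s].
rewrite -(@integral_indic _ (measurableTypeR R) R lam U)//; last exact: measurable_unit_itv.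
transitivity (\int[lam]_(t in U) ((f (quadrant t))%:R : R)%:E).
  apply: eq_integral => t _; rewrite indicE; congr ((nat_of_bool _)%:R%:E).
  by apply/idP/idP => [/set_mem//|ft]; apply/mem_set.
rewrite (@ge0_integral_finite_valued _ _ (measurableTypeR R) lam _ quadrant
  measurable_quadrant U (fun s => (f s)%:R))//; last exact: measurable_unit_itv.
rewrite /pmean -sumEFin; apply: eq_bigr => s _.
by rewrite EFinM quadrant_lawE muleC.
Qed.

Lemma quadrant_law_sum1 : (\sum_s quadrant_law s = 1)%R.
Proof.
have := lebesgue_quadrant xpredT; rewrite (_ : [set t | _] = U); last first.
  by apply/seteqP; split=> t // [].
rewrite lebesgue_unit_itv => -[->]; rewrite /pmean.
by apply: eq_bigr => s _; rewrite mulr1.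
Qed.

Lemma lebesgue_row : lam [set t | U t /\ S t] = (pmean quadrant_law (in_row R))%:E.
Proof.
rewrite -(lebesgue_quadrant (fun s => s.1)); congr (lam _).
by apply/seteqP; split=> t [Ut] /=; [move/mem_set|move/set_mem].
Qed.

Lemma lebesgue_col : lam [set t | U t /\ T t] = (pmean quadrant_law (in_col R))%:E.
Proof.
rewrite -(lebesgue_quadrant (fun s => s.2)); congr (lam _).
by apply/seteqP; split=> t [Ut] /=; [move/mem_set|move/set_mem].
Qed.

Lemma lebesgue_both : lam [set t | U t /\ (S `*` T) (t, t)] = (pmean quadrant_law (in_both R))%:E.
Proof.
rewrite -(lebesgue_quadrant (fun s => s.1 && s.2)); congr (lam _).
apply/seteqP; split=> t [Ut] /=; first by move=> [/mem_set-> /mem_set->].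
by move=> /andP[/set_mem ? /set_mem].
Qed.

Lemma indic_rectangle (t u : R) :
  (\1_(S `*` T) (t, u) = in_row R (quadrant t) * in_col R (quadrant u))%R.
Proof.
rewrite indicE /in_row /in_col -natrM mulnb; congr (nat_of_bool _)%:R.
apply/idP/andP; first by move/set_mem => /= [/mem_set-> /mem_set->].
by move=> [/set_mem ? /set_mem ?]; apply/mem_set.
Qed.

Lemma lebesgue_rectangle_row t :
  lam [set y | U y /\ (S `*` T) (t, y)] =
  (in_row R (quadrant t) * pmean quadrant_law (in_col R))%:E.
Proof.
rewrite /in_row /=; have [tS|tS] := boolP (t \in S); rewrite /= ?mul1r ?mul0r.
  rewrite -lebesgue_col; congr (lam _); apply/seteqP; split=> y /=; first by move=> [? []].
  by move=> [? ?]; do !split=> //; exact: set_mem.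
transitivity (lam set0); last by rewrite measure0.
congr (lam _).
by apply/seteqP; split=> y // -[_ [/= /mem_set]]; rewrite (negbTE tS).
Qed.

Lemma lebesgue_rectangle_col t :
  lam [set x | U x /\ (S `*` T) (x, t)] =
  (in_col R (quadrant t) * pmean quadrant_law (in_row R))%:E.
Proof.
rewrite /in_col /=; have [tT|tT] := boolP (t \in T); rewrite /= ?mul1r ?mul0r.
  rewrite -lebesgue_row; congr (lam _); apply/seteqP; split=> y /=; first by move=> [? []].
  by move=> [? ?]; do !split=> //; exact: set_mem.
transitivity (lam set0); last by rewrite measure0.
congr (lam _).
by apply/seteqP; split=> y // -[_ [_ /= /mem_set]]; rewrite (negbTE tT).
Qed.

Lemma lebesgue_rectangle :
  (lam \x lam) ((S `*` T) `&` (U `*` U)) =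
  (pmean quadrant_law (in_row R) * pmean quadrant_law (in_col R))%:E.
Proof.
rewrite -setXI product_measure1E; last 2 first.
- exact: (measurableI _ _ mS (@measurable_unit_itv R)).
- exact: (measurableI _ _ mT (@measurable_unit_itv R)).
by rewrite EFinM -lebesgue_row -lebesgue_col; congr (lam _ * lam _); rewrite setIC.
Qed.

(** The bridge from integrals to finite sums: by independence, the pattern [phi] is distributed as a
    product of copies of [quadrant_law]. *)
Lemma integral_iid_uniform d (O : measurableType d) (P : probability O R)
    (X : nat -> O -> R) (V : finType) (e : V -> nat) (F : {ffun V -> bool * bool} -> R) :
  iid_uniform P X -> injective e -> (forall u, 0 <= F u)%R ->
  let phi w := [ffun v => quadrant (X (e v) w)] in
  measurable_fun setT (fun w => (F (phi w))%:E) /\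
  \int[P]_w (F (phi w))%:E = (fexp quadrant_law F)%:E.
Proof.
move=> iidX e_inj F0 phi.
have phiE u : phi @^-1` [set u] = \bigcap_v (X (e v) @^-1` (quadrant @^-1` [set u v])).
  apply/seteqP; split=> w /=; first by move=> <- v _; rewrite /= ffunE.
  by move=> H; apply/ffunP => v; rewrite ffunE; exact: H.
have mphi u : measurable (phi @^-1` [set u]).
  rewrite phiE; apply: fin_bigcap_measurable => // v _.
  by rewrite -[_ @^-1` _]setTI; apply: iidX.1 => //; exact: measurable_quadrant.
split; first exact: measurable_finite_valued.
rewrite ge0_integral_finite_valued// /fexp -sumEFin; apply: eq_bigr => u _.
rewrite setIT phiE muleC EFinM -prodEFin; congr (_ * _).
apply: etrans (iid_uniform_bigcap iidX e_inj (fun v => measurable_quadrant (u v))) _.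
by apply: eq_bigr => v _; rewrite quadrant_lawE.
Qed.

End Rectangle.

(** * Truncation *)

Section EsumTruncation.
Local Open Scope ereal_scope.
Context (R : realType).

Lemma esum_split_finite (K : choiceType) (W : finType) (h : W -> K) (f : K -> \bar R) :
  injective h -> (forall k, 0 <= f k) ->
  \esum_(k in [set: K]) f k = \sum_w f (h w) + \esum_(k in ~` range h) f k.
Proof.
move=> h_inj f0; rewrite (esumID (range h))// !setTI; congr (_ + _).
rewrite esum_image; last by move=> u v _ _; exact: h_inj.
rewrite esum_fset//; last exact: finite_finset.
rewrite (fsbigE (index_enum W)) ?index_enum_uniq//; last first.
  by move=> i _; rewrite mem_index_enum.
by apply: eq_bigl => i; rewrite in_setT.
Qed.

(** A finite set [X] carries all but [delta] of the sum, and [n] exceeds the rank [r] of each of its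
    elements, so every admissible [Y] contains [X]. *)
Lemma esum_tail_small (K : choiceType) (r : K -> nat) (f : K -> \bar R) (delta : R) :
  (forall k, 0 <= f k) -> \esum_(k in [set: K]) f k < +oo -> (0 < delta)%R ->
  exists n, forall Y, [set k | (r k < n)%N] `<=` Y ->
    \esum_(k in ~` Y) f k <= delta%:E.
Proof.
move=> f0 foo d0.
have ffin : \esum_(k in [set: K]) f k \is a fin_num.
  by rewrite ge0_fin_numE// esum_ge0.
have [_ [X [Xfin _] <-] fX] := ub_ereal_sup_adherent d0 ffin.
have /finite_seqP[s Xs] := Xfin.
exists (\max_(k <- s) r k).+1 => Y sY.
have XY : X `<=` Y.
  by rewrite Xs => k /= ks; apply: sY => /=; rewrite ltnS (leq_bigmax_seq (F := r)).
have splitY : \esum_(k in [set: K]) f k = \esum_(k in Y) f k + \esum_(k in ~` Y) f k.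
  by rewrite (esumID Y)// !setTI.
have XleY : \sum_(k \in X) f k <= \esum_(k in Y) f k by apply: esum_ge; exists X.
have Yfin : \esum_(k in Y) f k \is a fin_num.
  rewrite ge0_fin_numE ?esum_ge0//; apply: le_lt_trans foo.
  by rewrite splitY leeDl// esum_ge0.
rewrite -(@leeD2lE _ (\esum_(k in Y) f k))// -splitY -leeBlDr//.
by apply: le_trans XleY; exact: ltW.
Qed.

(** Here [u] is the weighted tail, dominated by the unweighted tail [tau] because [g] is at most
    1. *)
Lemma esum_weighted_split (K : choiceType) (W : finType) (h : W -> K) (f g : K -> R) (tau : R) :
  injective h -> (forall k, 0 <= f k)%R -> (forall k, 0 <= g k <= 1)%R ->
  \esum_(k in ~` range h) (f k)%:E = tau%:E ->
  exists2 u : R, (0 <= u <= tau)%R &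
    \esum_(k in [set: K]) (f k)%:E * (g k)%:E = (\sum_w f (h w) * g (h w) + u)%:E.
Proof.
move=> h_inj f0 g01 ftau.
have fg0 k : 0 <= (f k)%:E * (g k)%:E.
  by rewrite mule_ge0 ?lee_fin//; case/andP: (g01 k).
have tle : \esum_(k in ~` range h) (f k)%:E * (g k)%:E <= tau%:E.
  rewrite -ftau; apply: le_esum => k _; rewrite -EFinM lee_fin ler_piMr//.
  by case/andP: (g01 k).
have t0 : 0 <= \esum_(k in ~` range h) (f k)%:E * (g k)%:E by exact: esum_ge0.
have tfin : \esum_(k in ~` range h) (f k)%:E * (g k)%:E \is a fin_num.
  by rewrite ge0_fin_numE// (le_lt_trans tle) ?ltry.
exists (fine (\esum_(k in ~` range h) (f k)%:E * (g k)%:E)).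
  by rewrite fine_ge0//= -lee_fin fineK.
rewrite (esum_split_finite h_inj)// EFinD fineK// -sumEFin.
by congr (_ + _); apply: eq_bigr => w _; rewrite EFinM.
Qed.

End EsumTruncation.

(** Both [u1 + u2 + u3] and [(t1 + t2 + t3) * (a * b)] lie between 0 and [3 * h], hence so does the
    absolute value of their difference. *)
Lemma truncation_error (R : realFieldType) (D1 D2 D3 u1 u2 u3 t1 t2 t3 th vth a b c h : R) :
  (0 <= u1 <= t1)%R -> (0 <= u2 <= t2)%R -> (0 <= u3 <= t3)%R ->
  (t1 <= h)%R -> (t2 <= h)%R -> (t3 <= h)%R ->
  (0 <= a <= 1)%R -> (0 <= b <= 1)%R ->
  (`|(D1 + u1) + (D2 + u2) + (D3 + u3) + th * (a * b) + vth * c -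
     (D1 + D2 + D3 + (th + t1 + t2 + t3) * (a * b) + vth * c)| <= 3 * h)%R.
Proof.
move=> /andP[u10 u1t] /andP[u20 u2t] /andP[u30 u3t] t1h t2h t3h /andP[a0 a1] /andP[b0 b1].
have ab0 : (0 <= a * b)%R by rewrite mulr_ge0.
have ab1 : (a * b <= 1)%R by rewrite mulr_ile1.
have t0 : (0 <= t1 + t2 + t3)%R by lra.
have tab1 : ((t1 + t2 + t3) * (a * b) <= t1 + t2 + t3)%R by rewrite ler_piMr.
have tab0 : (0 <= (t1 + t2 + t3) * (a * b))%R by rewrite mulr_ge0.
rewrite (_ : (_ - _ = u1 + u2 + u3 - (t1 + t2 + t3) * (a * b))%R); last by ring.
by rewrite ler_norml; apply/andP; split; lra.
Qed.

Section GrapheurTruncation.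
Local Open Scope ereal_scope.
Context (R : realType) (c : grapheur_coef R).
Hypothesis hc : is_grapheur c.
Variable h : R.
Hypothesis h0 : (0 < h)%R.

(* Total mass 1 is restored by putting the truncated mass on [theta]. *)
Definition truncated_theta n : R :=
  (1 - \sum_(i < n) \sum_(j < n) gE c i j - \sum_(i < n) gsig c i
     - \sum_(i < n) gvsig c i - gvtheta c)%R.

Definition pair_val n (q : 'I_n * 'I_n) : nat * nat := (val q.1, val q.2).

Lemma pair_val_inj n : injective (@pair_val n).
Proof. by move=> [i j] [i' j'] [/val_inj-> /val_inj->]. Qed.

(** The level [n] is fixed before the sequence, the outcome, the rectangle and [L], so the error
    bound is pointwise and uniform. The inequality on [theta] keeps the new coefficient
    nonnegative. *)
Lemma grapheur_truncation : exists n,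
  (gtheta c <= truncated_theta n)%R /\
  forall d (O : measurableType d) (X : nat -> O -> R) o (S T : set R) L
    (w : {ffun 'I_n + 'I_L -> bool * bool}),
  measurable S -> measurable T ->
  (forall i, w (inl i) = quadrant S T (X i o)) ->
  exists2 r : R, grapheur_rm c X o (S `*` T) = r%:E &
    (`|r - dust_value (fun i j : 'I_n => gE c i j) (fun i : 'I_n => gsig c i)
         (fun i : 'I_n => gvsig c i) (truncated_theta n) (gvtheta c)
         (quadrant_law S T) w| <= 3 * h)%R.
Proof.
have [E0 [s0 [v0 [th0 [vth0 mass]]]]] := hc.
have [EF SF VF] : [/\ \esum_(p in [set: nat * nat]) (gE c p.1 p.2)%:E \is a fin_num,
    \esum_(i in [set: nat]) (gsig c i)%:E \is a fin_num &
    \esum_(i in [set: nat]) (gvsig c i)%:E \is a fin_num].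
  have : \esum_(p in [set: nat * nat]) (gE c p.1 p.2)%:E +
      \esum_(i in [set: nat]) (gsig c i)%:E +
      \esum_(i in [set: nat]) (gvsig c i)%:E + (gtheta c)%:E + (gvtheta c)%:E \is a fin_num.
    by rewrite mass.
  by rewrite !fin_numD => /andP[/andP[/andP[/andP[-> ->] ->] _] _].
(* One statement serves pairs, ranked by the maximum of their indices, and single indices. *)
have pick_tail (K : choiceType) (r : K -> nat) (f : K -> R) : (forall k, 0 <= f k)%R ->
    \esum_(k in [set: K]) (f k)%:E \is a fin_num -> exists n0, forall m, (n0 <= m)%N ->
    forall W : finType, forall g : W -> K, injective g -> (forall k, (r k < m)%N -> range g k) ->
    exists t : R, [/\ (t <= h)%R, \esum_(k in ~` range g) (f k)%:E = t%:E &
     \esum_(k in [set: K]) (f k)%:E = (\sum_w f (g w) + t)%:E].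
  move=> f0 ffin; have f0' k : 0 <= (f k)%:E by rewrite lee_fin.
  have foo : \esum_(k in [set: K]) (f k)%:E < +oo.
    by rewrite -ge0_fin_numE// esum_ge0.
  have [n0 n0P] := esum_tail_small r f0' foo h0.
  exists n0 => m nm W g g_inj gP; exists (fine (\esum_(k in ~` range g) (f k)%:E)).
  have tle : \esum_(k in ~` range g) (f k)%:E <= h%:E.
    by apply: n0P => k /= kn; apply: gP; exact: leq_trans nm.
  have tfin : \esum_(k in ~` range g) (f k)%:E \is a fin_num.
    by rewrite ge0_fin_numE ?esum_ge0// (le_lt_trans tle) ?ltry.
  split; [by rewrite -lee_fin fineK|by rewrite fineK|].
  by rewrite EFinD fineK// -sumEFin; exact: esum_split_finite.
have [n1 n1P] := pick_tail _ (fun p : nat * nat => maxn p.1 p.2) _ (fun p => E0 p.1 p.2) EF.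
have [n2 n2P] := pick_tail _ id _ s0 SF.
have [n3 n3P] := pick_tail _ id _ v0 VF.
pose n := maxn n1 (maxn n2 n3).
have ord_range k : (k < n)%N -> range (@nat_of_ord n) k.
  by move=> kn; exists (Ordinal kn).
have n1n : (n1 <= n)%N by exact: leq_maxl.
have n2n : (n2 <= n)%N by rewrite /n !leq_max leqnn orbT.
have n3n : (n3 <= n)%N by rewrite /n !leq_max leqnn !orbT.
have [|t1 [t1h t1E massE]] := n1P n n1n _ _ (@pair_val_inj n).
  by move=> [i j]; rewrite gtn_max => /andP[/= ni nj]; exists (Ordinal ni, Ordinal nj).
have [t2 [t2h t2E massS]] := n2P n n2n _ _ (@ord_inj n) ord_range.
have [t3 [t3h t3E massV]] := n3P n n3n _ _ (@ord_inj n) ord_range.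
(* Since the total mass is 1, the new [theta] is the old one plus the three tails. *)
have tE : truncated_theta n = (gtheta c + t1 + t2 + t3)%R.
  move: mass; rewrite massE massS massV -!EFinD => -[mass1].
  rewrite /truncated_theta -mass1 (pair_bigA _ (fun i j : 'I_n => gE c i j)) /=.
  ring.
have t10 : (0 <= t1)%R by rewrite -lee_fin -t1E; apply: esum_ge0 => p _; rewrite lee_fin.
have t20 : (0 <= t2)%R by rewrite -lee_fin -t2E; apply: esum_ge0 => p _; rewrite lee_fin.
have t30 : (0 <= t3)%R by rewrite -lee_fin -t3E; apply: esum_ge0 => p _; rewrite lee_fin.
exists n; split; first by rewrite tE -!addrA lerDl !addr_ge0.
move=> d O X o S T L w mS mT wE; rewrite tE.
have p0 := @quadrant_law_ge0 R S T; have p1 := quadrant_law_sum1 mS mT.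
have rowP := in_row01 R; have colP := in_col01 R.
have /andP[a0 a1] := pmean_bounds p0 p1 rowP; have /andP[b0 b1] := pmean_bounds p0 p1 colP.
set a := pmean _ _ in a0 a1; set b := pmean _ _ in b0 b1.
pose q i := quadrant S T (X i o).
have prod01 (y z : R) : (0 <= y <= 1)%R -> (0 <= z <= 1)%R -> (0 <= y * z <= 1)%R.
  by move=> /andP[y0 y1] /andP[z0 z1]; rewrite mulr_ge0// mulr_ile1.
have ab0 : (0 <= a <= 1)%R by rewrite a0.
have bb0 : (0 <= b <= 1)%R by rewrite b0.
have [u1 u1P esE] := esum_weighted_split (f := fun p : nat * nat => gE c p.1 p.2)
  (@pair_val_inj n) (fun p => E0 p.1 p.2) (fun p => prod01 _ _ (rowP (q p.1)) (colP (q p.2))) t1E.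
have [u2 u2P esS] := esum_weighted_split (@ord_inj n) s0 (fun i => prod01 _ _ (rowP (q i)) bb0) t2E.
have [u3 u3P esV] := esum_weighted_split (@ord_inj n) v0 (fun i => prod01 _ _ (colP (q i)) ab0) t3E.
eexists.
  rewrite /grapheur_rm.
  under eq_esum do rewrite indic_rectangle.
  under [X in _ + X + _ + _ + _]eq_esum do rewrite (lebesgue_rectangle_row mS mT).
  under [X in _ + X + _ + _]eq_esum do rewrite (lebesgue_rectangle_col mS mT).
  rewrite (lebesgue_rectangle mS mT) (lebesgue_both mS mT) esE esS esV.
  by rewrite -!EFinM -!EFinD.
have := truncation_error (\sum_(k : 'I_n * 'I_n) gE c k.1 k.2 * (in_row R (q k.1) * in_col R (q k.2)))
 (\sum_(i < n) gsig c i * (in_row R (q i) * b)) (\sum_(i < n) gvsig c i * (in_col R (q i) * a))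
 (gtheta c) (gvtheta c) (pmean (quadrant_law S T) (in_both R)) u1P u2P u3P t1h t2h t3h ab0 bb0.
congr (`|_ - _| <= _)%R; rewrite /dust_value.
congr (_ + _ + _ + _ + _)%R.
- rewrite [RHS](pair_bigA _ (fun i j : 'I_n => gE c i j * (in_row R (w (inl i)) * in_col R (w (inl j))))%R).
  by apply: eq_bigr => k _; rewrite !wE.
- by apply: eq_bigr => i _; rewrite wE mulrA.
- by apply: eq_bigr => i _; rewrite wE mulrA.
Qed.

End GrapheurTruncation.

(** * The sampled graph *)

Section MatrixCoef.
Local Open Scope ereal_scope.
Context (R : realType) (N : nat) (G : 'M[R]_N).
Hypothesis G0 : forall i j, (0 <= G i j)%R.

Lemma gE_mx_coef (i j : 'I_N) : gE (mx_coef G) i j = G i j.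
Proof. by rewrite /= !valK. Qed.

Lemma gE_mx_coef_out (p : nat * nat) : ~ range (@pair_val N) p ->
  gE (mx_coef G) p.1 p.2 = 0%R.
Proof.
case: p => i j /= pN; case: insubP => // i' iN ii'; case: insubP => // j' jN jj'.
by case: pN; exists (i', j') => //; rewrite /pair_val /= ii' jj'.
Qed.

Lemma gE_mx_coef_ge0 i j : (0 <= gE (mx_coef G) i j)%R.
Proof. by rewrite /=; case: insubP => // i' _ _; case: insubP. Qed.

Lemma esum_mx_coef (f : nat * nat -> R) : (forall p, (0 <= f p)%R) ->
  \esum_(p in [set: nat * nat]) (gE (mx_coef G) p.1 p.2)%:E * (f p)%:E =
  (\sum_i \sum_j G i j * f (val i, val j))%:E.
Proof.
move=> f0; rewrite (esum_split_finite (@pair_val_inj N)); last first.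
  by move=> p; rewrite mule_ge0// lee_fin// gE_mx_coef_ge0.
rewrite [X in _ + X]esum1 ?adde0 => [|p pN]; last by rewrite gE_mx_coef_out// mul0e.
rewrite (pair_bigA _ (fun i j => G i j * f (val i, val j)))%R -sumEFin.
by apply: eq_bigr => -[i j] _; rewrite [pair_val _]/= gE_mx_coef EFinM.
Qed.

Lemma is_grapheur_mx_coef : (\sum_i \sum_j G i j = 1)%R -> is_grapheur (mx_coef G).
Proof.
move=> G1; split; first exact: gE_mx_coef_ge0.
do 4!(split; first by move=> *; exact: lexx).
rewrite [X in _ + X + _ + _ + _]esum1// [X in _ + X + _ + _]esum1// !adde0.
have := esum_mx_coef (f := fun=> 1%R) (fun=> ler01).
under eq_esum do rewrite mule1.
move=> ->; congr (_%:E); rewrite -[RHS]G1.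
by apply: eq_bigr => i _; apply: eq_bigr => j _; rewrite mulr1.
Qed.

Lemma grapheur_rm_mx_coef d (O : measurableType d) (X : nat -> O -> R) w A :
  grapheur_rm (mx_coef G) X w A =
  (\sum_i \sum_j G i j * \1_A (X i w, X j w))%:E.
Proof.
rewrite /grapheur_rm.
rewrite [X in _ + X + _ + _ + _]esum1 => [|i _]; last by rewrite mul0e.
rewrite [X in _ + X + _ + _]esum1 => [|i _]; last by rewrite mul0e.
by rewrite !mul0e !adde0 (esum_mx_coef (f := fun p => \1_A (X p.1 w, X p.2 w))).
Qed.

End MatrixCoef.

Section SampledGraph.
Local Open Scope ereal_scope.
Context (R : realType) (V : finType) (k : nat) (s : seq (V * V)).
Hypotheses (sk : size s = k) (k0 : (0 < k)%N).

(** Keeping only endpoints of sampled edges bounds the number of vertices by [2 * k], whatever the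
    truncation level. *)
Definition sample_vertices : seq V := undup ([seq q.1 | q <- s] ++ [seq q.2 | q <- s]).
Local Notation N := (size sample_vertices).

Definition sample_vertex (i : 'I_N) : V := tnth (in_tuple sample_vertices) i.

Definition sample_graph : 'M[R]_N :=
  (\matrix_(i, j) ((count_mem (sample_vertex i, sample_vertex j) s)%:R / k%:R))%R.

Lemma sample_vertices_size : (N <= 2 * k)%N.
Proof.
apply: leq_trans (size_undup _) _.
by rewrite size_cat !size_map sk mul2n addnn.
Qed.

Lemma sample_vertex_inj : injective sample_vertex.
Proof. exact/tuple_uniqP/undup_uniq. Qed.

Lemma sum_sample_vertex (F : V -> R) :
  (forall v, v \notin sample_vertices -> F v = 0%R) ->
  (\sum_i F (sample_vertex i) = \sum_v F v)%R.
Proof.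
move=> F0; rewrite -(big_tnth _ _ sample_vertices xpredT) big_uniq ?undup_uniq//=.
by rewrite big_mkcond; apply: eq_bigr => v _; case: ifPn => // /F0.
Qed.

(** An edge with an endpoint outside [sample_vertices] has multiplicity 0, so restricting to these
    vertices loses nothing. *)
Lemma sum_sample_graph (F : V -> V -> R) :
  (\sum_i \sum_j sample_graph i j * F (sample_vertex i) (sample_vertex j) =
   \sum_q (count_mem q s)%:R / k%:R * F q.1 q.2)%R.
Proof.
have out q : (q.1 \notin sample_vertices) || (q.2 \notin sample_vertices) -> count_mem q s = 0%N.
  rewrite !mem_undup !mem_cat => qs; apply/count_memPn; apply: contraL qs => qs.
  by rewrite negb_or !negbK !map_f ?orbT.
pose H u v := ((count_mem (u, v) s)%:R / k%:R * F u v)%R.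
transitivity (\sum_u \sum_v H u v)%R; last first.
  by rewrite (pair_bigA _ H); apply: eq_bigr => -[].
rewrite -sum_sample_vertex => [|u us]; last first.
  by apply: big1 => v _; rewrite /H out ?mul0r//= us.
apply: eq_bigr => i _; rewrite -sum_sample_vertex => [|u us].
  by apply: eq_bigr => j _; rewrite mxE.
by rewrite /H out ?mul0r//= us orbT.
Qed.

Lemma sample_graph_sum1 : (\sum_i \sum_j sample_graph i j = 1)%R.
Proof.
have := sum_sample_graph (fun _ _ => 1%R).
under eq_bigr do under eq_bigr do rewrite mulr1.
move=> ->; under eq_bigr do rewrite mulrAC.
rewrite -mulr_suml (sum_count_mem (fun=> 1%R)) big_const_seq count_predT sk iter_addr_0.
by rewrite divff// pnatr_eq0 -lt0n.
Qed.

End SampledGraph.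

(** * Couplings and the bound on [W_box] *)

Lemma grapheur_law_vacuous (R : realType) (c : grapheur_coef R) d (O : measurableType d)
    (P : probability O R) X :
  ~ (exists d0 (O0 : measurableType d0) (P0 : probability O0 R) (T : nat -> O0 -> R),
      iid_uniform P0 T) -> has_grapheur_law c P X.
Proof. by move=> noiid d0 O0 P0 T iidT; case: noiid; exists d0, O0, P0, T. Qed.

(* [has_grapheur_law] quantifies over i.i.d. uniform sequences; if there were none,
   it would be vacuous. This case distinction spares the construction of a sequence. *)
Lemma W_box_vacuous (R : realType) (c1 c2 : grapheur_coef R) :
  ~ (exists d0 (O0 : measurableType d0) (P0 : probability O0 R) (T : nat -> O0 -> R),
      iid_uniform P0 T) -> (W_box c1 c2 <= 0)%E.
Proof.
move=> noiid; apply: ge_ereal_inf; eexists; last exact: lexx.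
exists _, unit, (dirac tt : probability unit R), (fun=> mzero), (fun=> mzero).
split; [by move=> A mA; exact: measurable_cst|by move=> A mA; exact: measurable_cst
  |exact: grapheur_law_vacuous|exact: grapheur_law_vacuous|].
apply/eqP; rewrite eq_le; apply/andP; split.
  (* A degenerate interval shows that the supremum ranges over a nonempty set, so it is 0 and not
     [-oo]. *)
  apply: ereal_sup_ubound; exists `[0%R, 0%R], `[0%R, 0%R].
  have sub : [set` (`[0%R, 0%R] : interval R)] `<=` unit_itv R.
    by move=> t /=; rewrite /unit_itv /= !in_itv /= => /andP[-> /le_trans->//].
  split=> //; rewrite -[LHS](@integral0 _ _ _ (dirac tt : probability unit R) setT).
  by apply: eq_integral => w _; rewrite /mzero sube0 abse0.
apply: ge_ereal_sup => _ [S [T [_ _ ->]]].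
by rewrite integral0_eq// => w _; rewrite /mzero sube0 abse0.
Qed.

(** Arguments from [N] on are shifted by [m], beyond all values of [g]. *)
Lemma extend_injection N (g : 'I_N -> nat) : injective g ->
  exists f : nat -> nat, injective f /\ forall i : 'I_N, f i = g i.
Proof.
move=> g_inj; pose m := (\max_i g i).+1.
have gm i : (g i < m)%N by rewrite ltnS leq_bigmax.
exists (fun i => if insub i is Some i' then g i' else m + i)%N; split; last first.
  by move=> i; rewrite valK.
move=> i j; case: insubP => [i' _ <-|_]; case: insubP => [j' _ <-|_].
- by move/g_inj ->.
- by move=> gE; have := gm i'; rewrite gE ltnNge leq_addr.
- by move=> gE; have := gm j'; rewrite -gE ltnNge leq_addr.
- by move/addnI.
Qed.

(** Atoms keep their index in the sequence and fresh vertices read it from [n] on. The truncated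
    atoms share those variables, which is harmless since the truncation bound is pointwise. *)
Definition blowup_vertex n L (v : 'I_n + 'I_L) : nat :=
  match v with inl i => i | inr l => (n + l)%N end.

Lemma blowup_vertex_inj n L : injective (@blowup_vertex n L).
Proof.
move=> [i|l] [j|m] /=.
- by move/ord_inj ->.
- by move=> ij; have := ltn_ord i; rewrite ij ltnNge leq_addr.
- by move=> ij; have := ltn_ord j; rewrite -ij ltnNge leq_addr.
- by move/addnI/ord_inj ->.
Qed.

Section Coupling.
Context (R : realType) (c : grapheur_coef R) (n k : nat) (th h : R).
Variable s : seq (('I_n + 'I_k) * ('I_n + 'I_k)).
Hypotheses (hc : is_grapheur c) (h0 : 0 < h) (sk : size s = k) (k0 : (0 < k)%N).
Local Notation dust := (dust_value (fun i j : 'I_n => gE c i j)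
  (fun i : 'I_n => gsig c i) (fun i : 'I_n => gvsig c i) th (gvtheta c)).
Local Notation G := (sample_graph R k s).

Hypothesis truncation : forall d (O : measurableType d) (X : nat -> O -> R) o (S T : set R)
    (w : {ffun 'I_n + 'I_k -> bool * bool}), measurable S -> measurable T ->
  (forall i, w (inl i) = quadrant S T (X i o)) ->
  exists2 r : R, grapheur_rm c X o (S `*` T) = r%:E &
    `|r - dust (quadrant_law S T) w| <= 3 * h.

Hypothesis sampling : forall p : bool * bool -> R, (forall q, 0 <= p q) -> \sum_q p q = 1 ->
  fexp p (fun w => `|\sum_q (count_mem q s)%:R / k%:R * (in_row R (w q.1) * in_col R (w q.2))
     - dust p w|) <= 18 * h.

Lemma W_box_sample_graph : (W_box c (mx_coef G) <= (21 * h)%:E)%E.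
Proof.
have [noiid|hasiid] := pselect (~ (exists d0 (O0 : measurableType d0) (P0 : probability O0 R)
    (T : nat -> O0 -> R), iid_uniform P0 T)).
  by apply: le_trans (W_box_vacuous _ _ noiid) _; rewrite lee_fin mulr_ge0// ltW.
have [d [Om [P [X iidX]]]] := contrapT hasiid.
have G0 i j : 0 <= G i j by rewrite mxE divr_ge0.
have hG := is_grapheur_mx_coef G0 (sample_graph_sum1 R sk k0).
(* [f] sends a row of the matrix to the position of its vertex in [X], so both measures read the
   same variables; the reindexed sequence is still i.i.d. and yields the right law. *)
have [f [f_inj fE]] := extend_injection
  (inj_comp (@blowup_vertex_inj n k) (@sample_vertex_inj _ s)).
pose Y i := X (f i).
have iidY : iid_uniform P Y by exact: iid_uniform_inj.
apply: ge_ereal_inf; eexists.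
  exists d, Om, P, (fun w => grapheur_measure hc (X^~ w)), (fun w => grapheur_measure hG (Y^~ w)).
  split; last reflexivity.
  - exact: random_measure_grapheur iidX.1.
  - exact: random_measure_grapheur iidY.1.
  - exact: has_grapheur_law_iid.
  - exact: has_grapheur_law_iid.
apply: ge_ereal_sup => _ [I [J [_ _ ->]]].
have mI : measurable [set` I] by exact: measurable_itv.
have mJ : measurable [set` J] by exact: measurable_itv.
set S := [set` I] in mI *; set T := [set` J] in mJ *.
(* A pointwise majorant of the integrand depending only on quadrants: the sampling error, of mean at
   most [18 * h], plus the truncation error [3 * h]. *)
pose F (w : {ffun 'I_n + 'I_k -> bool * bool}) : R :=
  `|\sum_q (count_mem q s)%:R / k%:R * (in_row R (w q.1) * in_col R (w q.2))
     - dust (quadrant_law S T) w| + 3 * h.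
have F0 w : 0 <= F w by rewrite addr_ge0// mulr_ge0// ltW.
have [mF FE] := integral_iid_uniform mI mJ iidX (@blowup_vertex_inj n k) F0.
have p0 := @quadrant_law_ge0 R S T; have p1 := quadrant_law_sum1 mI mJ.
apply: (@le_trans _ _ (fexp (quadrant_law S T) F)%:E); last first.
  rewrite lee_fin /F fexpD fexp_cst//; have := sampling p0 p1; lra.
rewrite -FE; apply: ge0_le_integral => //.
- apply: measurableT_comp => //; apply: emeasurable_funB.
    by apply: (random_measure_grapheur hc iidX.1); exact: measurableX.
  by apply: (random_measure_grapheur hG iidY.1); exact: measurableX.
move=> w _; set phi := finfun _.
have phiE v : phi v = quadrant S T (X (blowup_vertex v) w) by rewrite ffunE.
rewrite !grapheur_measureE (grapheur_rm_mx_coef G0).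
have [r -> rP] := @truncation _ _ X w S T phi mI mJ (fun i => phiE (inl i)).
have -> : \sum_i \sum_j G i j * \1_(S `*` T) (Y i w, Y j w) =
    \sum_q (count_mem q s)%:R / k%:R * (in_row R (phi q.1) * in_col R (phi q.2)).
  rewrite -(sum_sample_graph k s (fun u v => in_row R (phi u) * in_col R (phi v))).
  apply: eq_bigr => i _; apply: eq_bigr => j _; congr (_ * _).
  by rewrite indic_rectangle /Y !fE !phiE.
rewrite -EFinB abse_EFin lee_fin /F.
apply: le_trans (ler_distD (dust (quadrant_law S T) phi) _ _) _.
by rewrite addrC distrC; apply: lerD; rewrite // distrC.
Qed.

End Coupling.

Theorem mainTheorem13 (R : realType) (c : grapheur_coef R) (hc : is_grapheur c)
    (eps : R) (heps : 0 < eps) :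
  let k : nat := `|Num.ceil ((174 / eps) ^+ 2)|%N in
  exists (N : nat) (G : 'M[R]_N),
    [/\ (N <= 2 * k)%N,
        (forall i j, 0 <= G i j),
        \sum_(i < N) \sum_(j < N) G i j = 1,
        (forall i j, exists m : nat, G i j = m%:R / k%:R) &
        (W_box c (mx_coef G) <= eps%:E)%E].
Proof.
(* The total error [21 * h] is below [174 * h = eps], and [k] is exactly large enough for
   [1 / k <= h ^+ 2]. *)
move=> k; pose h := eps / 174.
have h0 : 0 < h by rewrite divr_gt0.
have kE : (174 / eps) ^+ 2 <= k%:R.
  rewrite /k natr_absz ger0_norm ?ceil_ge// ceil_ge0.
  by apply: lt_le_trans (sqr_ge0 _); rewrite ltrN10.
have sq0 : 0 < (174 / eps) ^+ 2 by rewrite exprn_gt0// divr_gt0.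
have k0 : (0 < k)%N by rewrite -(ltr0n R); exact: lt_le_trans kE.
have kh : k%:R^-1 <= h ^+ 2.
  rewrite -[h ^+ 2]invrK lef_pV2 ?posrE ?ltr0n// ?invr_gt0 ?exprn_gt0//.
  by rewrite -exprVn /h invf_div.
have [n [thn trunc]] := grapheur_truncation hc h0.
have th0 : 0 <= truncated_theta c n by apply: le_trans thn; exact: gtheta_ge0.
have mass : \sum_(i < n) \sum_(j < n) gE c i j + \sum_(i < n) gsig c i +
    \sum_(i < n) gvsig c i + truncated_theta c n + gvtheta c = 1.
  by rewrite /truncated_theta; ring.
have [s [sk sP]] := finite_grapheur_sampling (fun i j : 'I_n => gE_ge0 hc i j)
  (fun i : 'I_n => gsig_ge0 hc i) (fun i : 'I_n => gvsig_ge0 hc i) th0 (gvtheta_ge0 hc)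
  mass k0 h0 kh.
exists (size (sample_vertices s)), (sample_graph R k s); split.
- exact: sample_vertices_size.
- by move=> i j; rewrite mxE divr_ge0.
- exact: sample_graph_sum1.
- by move=> i j; rewrite mxE; eexists.
apply: (@le_trans _ _ (21 * h)%:E).
  apply: W_box_sample_graph sP => // d O X o S T w mS mT wE.
  exact: (trunc d O X o S T k w mS mT wE).
by rewrite lee_fin /h; lra.
Qed.
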